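(* For all real $x>0$ and all $k\in\mathbb{N}$, the double inequality $$\frac{(k-1)!}{\Bigl\{x+\Bigl[\frac{(k-1)!}{\vert\psi^{(k)}(1)\vert}\Bigr]^{1/k}\Bigr\}^k}+\frac{k!}{x^{k+1}}<\bigl\vert\psi^{(k)}(x)\bigr\vert<\frac{(k-1)!}{\bigl(x+\frac12\bigr)^k}+\frac{k!}{x^{k+1}}$$ holds, and the constants $\Bigl[\frac{(k-1)!}{\vert\psi^{(k)}(1)\vert}\Bigr]^{1/k}$ (in the lower bound) and $\frac12$ (in the upper bound) are the best possible.
   Context: $\mathbb{N}=\{1,2,3,\dots\}$. For $x>0$, $\Gamma(x)=\int_0^\infty t^{x-1}e^{-t}\,dt$ is the Euler gamma function, $\psi(x)=\Gamma'(x)/\Gamma(x)$ is the psi (digamma) function, and $\psi^{(k)}$ denotes the $k$-th derivative of $\psi$ (the polygamma functions, $k\in\mathbb{N}$). The $1/k$-th power is the positive real $k$-th root. ''Best possible'' means, for each fixed $k\in\mathbb{N}$: if $\alpha\ge 0$ is a real number such that $\frac{(k-1)!}{(x+\alpha)^k}+\frac{k!}{x^{k+1}}<\vert\psi^{(k)}(x)\vert$ for all $x>0$, then $\alpha\ge\bigl[\frac{(k-1)!}{\vert\psi^{(k)}(1)\vert}\bigr]^{1/k}$; and if $\beta\ge 0$ is a real number such that $\vert\psi^{(k)}(x)\vert<\frac{(k-1)!}{(x+\beta)^k}+\frac{k!}{x^{k+1}}$ for all $x>0$, then $\beta\le\frac12$. *)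

(* Defs.v *)
From Stdlib Require Import Reals Factorial.
From Coquelicot Require Import Coquelicot.
Open Scope R_scope.

(* For 0 < x < 1 the integrand is unbounded at 0, hence the integral is
   improper at both ends.  [Rpower t y] is [exp (y * ln t)], the usual real
   power for t > 0.  [RInt_gen] is total: Gamma is meaningful for x > 0 only. *)
Definition Gamma (x : R) : R :=
  RInt_gen (fun t => Rpower t (x - 1) * exp (- t))
           (at_right 0) (Rbar_locally p_infty).

Definition psi (x : R) : R := Derive Gamma x / Gamma x.

Definition polygamma (k : nat) (x : R) : R := Derive_n psi k x.

Definition polygamma_bound (k : nat) (c x : R) : R :=
  INR (fact (k - 1)) / (x + c) ^ k + INR (fact k) / x ^ (k + 1).

(* [Rpower a (/ INR k)] is the positive k-th root of a > 0; the base is positive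
   since polygamma k 1 <> 0 for k >= 1. *)
Definition lower_const (k : nat) : R :=
  Rpower (INR (fact (k - 1)) / Rabs (polygamma k 1)) (/ INR k).

(* Main.v *)
Require Import Defs.
From Stdlib Require Import Reals Factorial Lra Lia Ranalysis5 Classical.
From Coquelicot Require Import Coquelicot.
Open Scope R_scope.

(* Since [ln Gamma] is convex and [Gamma (x + 1) = x * Gamma x], Gauss's product for
   [Gamma] holds (Bohr-Mollerup), and differentiating its logarithm termwise gives
   [|psi^(k)(x)| = k! / x^(k+1) + k! T(x)] with [T(x) = sum_{n >= 1} 1/(x+n)^(k+1)].
   So the theorem compares [k T(x)] with [1/(x+c)^k]. The midpoint rule gives
   [k T(x) < 1/(x+1/2)^k], and the trapezoidal rule gives
   [k T(x) >= 1/x^k - (k/2)/x^(k+1)], which makes 1/2 optimal as [x] tends to infinity.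
   For the lower bound, [c] is the constant with [1/c^k = k T(0)], and optimality is
   seen at [x] near 0. The inequality itself says that the Laplace transform of
   [t^(k-1) (t/(e^t - 1) - e^(-ct))] is positive at [x > 0]; it vanishes at [x = 0] and
   the function changes sign once, from + to -, so damping by [e^(-xt)] leaves a
   positive integral. *)

(** * Improper integrals over the positive half-line *)

(** [polygamma] is an iterated derivative of a quotient built from an improper integral, so a form
    of [Gamma] is wanted that can be differentiated repeatedly. Convexity supplies one, the
    exponential of a series, and every later derivative is an M-test on [x > 0]. The single sign
    change is governed by [1/2 < c < 1]: near 0 the function [t/(e^t - 1) - e^(-ct)] behaves like
    [(c - 1/2) t], and for large [t] the term [t e^(-t)] falls below [e^(-ct)] exactly when [c < 1].
    Both inequalities for the actual constant come from the quadrature rules, the midpoint rule at 0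
    and the trapezoidal rule at 1. The integral containing [1/(e^t - 1)] is bounded below on a
    compact interval and above by finite sums of explicit integrals, so the passage to the limit
    takes place among numbers only. *)

Local Notation is_RInt_pos f l :=
  (is_RInt_gen f (at_right 0) (Rbar_locally p_infty) l).

(** Beyond [Rmax c d] the right endpoint exceeds [c], hence [a]; so eventual statements reduce to
    genuine intervals with [a < b]. *)
Lemma filter_prod_pos (P : R * R -> Prop) (c d : R) :
  0 < c ->
  (forall a b, 0 < a < c -> d < b -> a < b -> P (a, b)) ->
  filter_prod (at_right 0) (Rbar_locally p_infty) P.
Proof.
  intros hc hP.
  apply (Filter_prod _ _ _ (fun a => 0 < a < c) (fun b => Rmax c d < b)).
  - exists (mkposreal c hc). intros y hy h0. split; [exact h0|].
    unfold ball in hy; simpl in hy; unfold AbsRing_ball, abs, minus, plus, opp in hy;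
      simpl in hy.
    apply Rabs_def2 in hy. lra.
  - exists (Rmax c d). auto.
  - intros a b ha hb. pose proof (Rmax_l c d); pose proof (Rmax_r c d).
    apply hP; lra.
Qed.

Lemma is_RInt_pos_ext (f g : R -> R) (l : R) :
  (forall t, 0 < t -> f t = g t) -> is_RInt_pos f l -> is_RInt_pos g l.
Proof.
  intros h. apply is_RInt_gen_ext.
  apply (filter_prod_pos _ 1 0); [lra|]. intros a b ha _ hab t ht. simpl in ht.
  rewrite Rmin_left in ht by lra. apply h; lra.
Qed.

Lemma is_RInt_pos_le (f g : R -> R) (lf lg : R) :
  (forall t, 0 < t -> 0 <= f t <= g t) ->
  is_RInt_pos f lf -> is_RInt_pos g lg -> lf <= lg.
Proof.
  intros h hf hg. apply Rle_trans with (1 := Rle_abs lf).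
  refine (RInt_gen_norm f g lf lg _ _ hf hg);
    apply (filter_prod_pos _ 1 0); try lra; simpl; intros a b ha _ hab; [lra|].
  intros t ht. specialize (h t ltac:(lra)).
  change (Rabs (f t) <= g t). rewrite Rabs_pos_eq; lra.
Qed.

Lemma ex_RInt_pos_continuous (f : R -> R) (a b : R) :
  (forall t, 0 < t -> continuous f t) -> 0 < a -> 0 < b -> ex_RInt f a b.
Proof.
  intros hf ha hb. apply (ex_RInt_continuous (V := R_CompleteNormedModule)).
  intros z [hz _]. apply hf.
  apply Rlt_le_trans with (2 := hz). apply Rmin_glb_lt; assumption.
Qed.

Lemma RInt_pos_mono (f : R -> R) (a b c d : R) :
  (forall t, 0 < t -> continuous f t) -> (forall t, 0 < t -> 0 <= f t) ->
  0 < a -> a <= b -> b <= c -> c <= d -> RInt f b c <= RInt f a d.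
Proof.
  intros hc h0 ha hab hbc hcd.
  assert (e : forall u v, 0 < u -> 0 < v -> ex_RInt f u v)
    by (intros; apply ex_RInt_pos_continuous; auto).
  rewrite <- (RInt_Chasles f a b d), <- (RInt_Chasles f b c d) by (apply e; lra).
  change (RInt f b c <= RInt f a b + (RInt f b c + RInt f c d)).
  assert (0 <= RInt f a b)
    by (apply RInt_ge_0; [lra|apply e; lra|intros; apply h0; lra]).
  assert (0 <= RInt f c d)
    by (apply RInt_ge_0; [lra|apply e; lra|intros; apply h0; lra]).
  lra.
Qed.

(** Integrability up to both ends is assumed of the majorant [g] only. Widening the interval
    increases the integral of [f], so a limit for [g] below [RInt f a b] is impossible. *)
Lemma is_RInt_pos_ge (f g : R -> R) (l a b : R) :
  (forall t, 0 < t -> continuous f t) -> (forall t, 0 < t -> 0 <= f t <= g t) ->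
  is_RInt_pos g l -> 0 < a -> a < b -> RInt f a b <= l.
Proof.
  intros hc hfg hl ha hab. apply Rnot_lt_le. intros hlt.
  assert (he : 0 < RInt f a b - l) by lra.
  specialize (hl _ (locally_ball l (mkposreal _ he))).
  assert (hp := filter_prod_pos (fun ab => 0 < fst ab < a /\ b < snd ab) a b ha
                 ltac:(simpl; intros; lra)).
  unfold filtermapi in hl.
  destruct (filter_ex _ (filter_and _ _ hl hp)) as [[u v] [[y [hy hb]] [hu hv]]].
  simpl in *.
  assert (RInt f a b <= RInt f u v)
    by (apply RInt_pos_mono; auto; try lra; intros; apply hfg; assumption).
  assert (RInt f u v <= y).
  { apply (is_RInt_le f g u v); [lra| |exact hy|intros; apply hfg; lra].
    apply (RInt_correct f), ex_RInt_pos_continuous; auto; lra. }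
  unfold ball in hb; simpl in hb; unfold AbsRing_ball, abs, minus, plus, opp in hb;
    simpl in hb.
  apply Rabs_def2 in hb. lra.
Qed.

(** The limit is the supremum of the integrals over compact intervals: by monotonicity, any interval
    containing a nearly optimal one is at least as good. *)
Lemma ex_RInt_pos_bounded (f : R -> R) (M : R) :
  (forall t, 0 < t -> continuous f t) -> (forall t, 0 < t -> 0 <= f t) ->
  (forall a b, 0 < a -> a < b -> RInt f a b <= M) ->
  exists l, is_RInt_pos f l.
Proof.
  intros hc h0 hM.
  destruct (completeness (fun y => exists a b, 0 < a /\ a < b /\ y = RInt f a b))
    as [l [hub hlub]].
  - exists M. intros y (a & b & ha & hab & ->). auto.
  - exists (RInt f 1 2), 1, 2. lra.
  - exists l. intros P [eps hP].
    assert (hex : exists a b, 0 < a /\ a < b /\ l - eps < RInt f a b).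
    { apply NNPP. intros hn. assert (l <= l - eps).
      { apply hlub. intros y (a & b & ha & hab & ->). apply Rnot_lt_le. intros hlt.
        apply hn. exists a, b. auto. }
      pose proof (cond_pos eps). lra. }
    destruct hex as (a & b & ha & hab & hl).
    apply (filter_prod_pos _ a b ha). intros u v hu hv huv. simpl.
    exists (RInt f u v). split.
    + apply (RInt_correct f), ex_RInt_pos_continuous; auto; lra.
    + apply hP.
      assert (RInt f a b <= RInt f u v) by (apply RInt_pos_mono; auto; lra).
      assert (RInt f u v <= l) by (apply hub; exists u, v; repeat split; auto; lra).
      unfold ball; simpl; unfold AbsRing_ball, abs, minus, plus, opp; simpl.
      pose proof (cond_pos eps). apply Rabs_def1; lra.
Qed.

Lemma is_RInt_pos_derive (F f : R -> R) (la lb : R) :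
  (forall t, 0 < t -> is_derive F t (f t)) ->
  (forall t, 0 < t -> continuous f t) ->
  filterlim F (at_right 0) (locally la) -> is_lim F p_infty lb ->
  is_RInt_pos f (lb - la).
Proof.
  intros hF hf hla hlb.
  assert (hD : forall t, 0 < t -> Derive F t = f t)
    by (intros t ht; apply is_derive_unique; auto).
  apply (is_RInt_pos_ext (Derive F)); [exact hD|].
  apply is_RInt_gen_Derive; [| |exact hla|exact hlb];
    apply (filter_prod_pos _ 1 0); try lra; simpl; intros a b ha _ hab t ht;
    rewrite Rmin_left in ht by lra.
  - eexists; apply hF; lra.
  - apply (continuous_ext_loc _ f); [|apply hf; lra].
    assert (h : 0 < t) by lra.
    apply (filter_imp (fun u => 0 < u)); [intros u hu; symmetry; auto|].
    apply (open_gt 0). exact h.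
Qed.

(** * The Gamma function *)

Lemma exp_le_compat (x y : R) : x <= y -> exp x <= exp y.
Proof.
  intros [h| ->]; [left; apply exp_increasing; exact h|right; reflexivity].
Qed.

(** This is [1 + ln u <= u] at [u = t / (2 * x / a)], scaled by [x]. The factor 2 spends half of the
    decay rate [a] and leaves the other half for the limit at infinity. *)
Lemma Rpower_le_exp (x a t : R) :
  0 < x -> 0 < a -> 0 < t ->
  Rpower t x <= Rpower (2 * x / a) x * exp (a * t / 2).
Proof.
  intros hx ha ht. unfold Rpower. rewrite <- exp_plus. apply exp_le_compat.
  assert (hc : 0 < 2 * x / a) by (apply Rdiv_lt_0_compat; lra).
  assert (hu : 0 < t / (2 * x / a)) by (apply Rdiv_lt_0_compat; lra).
  pose proof (exp_ineq1_le (ln (t / (2 * x / a)))) as h.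
  rewrite exp_ln in h by assumption.
  rewrite ln_div in h by assumption.
  replace (a * t / 2) with (x * (t / (2 * x / a))) by (field; lra).
  nra.
Qed.

Lemma continuous_Rpower_exp (x a t : R) :
  0 < t -> continuous (fun t => Rpower t x * exp (- (a * t))) t.
Proof.
  intros ht. apply (ex_derive_continuous (V := R_NormedModule)).
  unfold Rpower. auto_derive. exact ht.
Qed.

Lemma Rpower_exp_at_0 (x a : R) :
  0 < x -> 0 < a ->
  filterlim (fun t => Rpower t x * exp (- (a * t))) (at_right 0) (locally 0).
Proof.
  intros hx ha P [eps hP]. pose proof (cond_pos eps) as he.
  exists (mkposreal _ (exp_pos (ln eps / x))). intros t ht h0.
  unfold ball in ht; simpl in ht; unfold AbsRing_ball, abs, minus, plus, opp in ht;
    simpl in ht.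
  apply Rabs_def2 in ht. apply hP.
  unfold ball; simpl; unfold AbsRing_ball, abs, minus, plus, opp; simpl.
  rewrite Ropp_0, Rplus_0_r.
  unfold Rpower. rewrite <- exp_plus, Rabs_pos_eq by (left; apply exp_pos).
  rewrite <- (exp_ln eps he). apply exp_increasing.
  assert (hl : ln t < ln eps / x).
  { rewrite <- (ln_exp (ln eps / x)). apply ln_increasing; lra. }
  apply (Rmult_lt_compat_l x) in hl; [|exact hx].
  replace (x * (ln eps / x)) with (ln eps) in hl by (field; lra).
  nra.
Qed.

Lemma Rpower_exp_at_infty (x a : R) :
  0 < x -> 0 < a ->
  is_lim (fun t => Rpower t x * exp (- (a * t))) p_infty 0.
Proof.
  intros hx ha P [eps hP]. pose proof (cond_pos eps) as he.
  set (K := Rpower (2 * x / a) x). assert (hK : 0 < K) by apply exp_pos.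
  exists (Rmax 0 (2 / a * (ln K - ln eps))). intros t ht. apply hP.
  pose proof (Rmax_l 0 (2 / a * (ln K - ln eps))).
  pose proof (Rmax_r 0 (2 / a * (ln K - ln eps))).
  unfold ball; simpl; unfold AbsRing_ball, abs, minus, plus, opp; simpl.
  rewrite Ropp_0, Rplus_0_r.
  assert (h0 : 0 < Rpower t x) by apply exp_pos.
  pose proof (exp_pos (- (a * t))).
  rewrite Rabs_pos_eq by nra.
  apply Rle_lt_trans with (K * exp (a * t / 2) * exp (- (a * t))).
  { apply Rmult_le_compat_r; [lra|]. apply Rpower_le_exp; lra. }
  rewrite Rmult_assoc, <- exp_plus.
  rewrite <- (exp_ln K hK), <- (exp_ln eps he), <- exp_plus.
  apply exp_increasing.
  assert (hl : 2 / a * (ln K - ln eps) < t) by lra.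
  apply (Rmult_lt_compat_l (a / 2)) in hl; [|lra].
  replace (a / 2 * (2 / a * (ln K - ln eps))) with (ln K - ln eps) in hl
    by (field; lra).
  lra.
Qed.

(** Integration by parts with vanishing boundary terms. The case [a = 1] is the functional equation
    of [Gamma]; general [a] drives the recursion for the integrals of [t ^ m * exp (- (a * t))]. *)
Lemma is_RInt_pos_Rpower_exp_derive (x a : R) :
  0 < x -> 0 < a ->
  is_RInt_pos (fun t => x * (Rpower t (x - 1) * exp (- (a * t)))
                        - a * (Rpower t x * exp (- (a * t)))) 0.
Proof.
  intros hx ha.
  refine (eq_ind _ (fun l => is_RInt_pos _ l) _ _ (Rminus_0_r 0)).
  apply (is_RInt_pos_derive (fun t => Rpower t x * exp (- (a * t)))).
  - intros t ht.
    replace (Rpower t (x - 1)) with (Rpower t x / t).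
    + unfold Rpower. auto_derive; [exact ht|]. field. lra.
    + unfold Rminus. rewrite Rpower_plus, Rpower_Ropp, Rpower_1 by exact ht. reflexivity.
  - intros t ht.
    apply (continuous_minus (V := R_NormedModule));
      apply (continuous_scal_r (V := R_NormedModule));
      apply continuous_Rpower_exp; exact ht.
  - apply Rpower_exp_at_0; assumption.
  - apply Rpower_exp_at_infty; assumption.
Qed.

Definition Gamma_integrand (x t : R) : R := Rpower t (x - 1) * exp (- t).

Lemma Gamma_integrand_pos (x t : R) : 0 < Gamma_integrand x t.
Proof. apply Rmult_lt_0_compat; apply exp_pos. Qed.

Lemma continuous_Gamma_integrand (x t : R) :
  0 < t -> continuous (Gamma_integrand x) t.
Proof.
  intros ht. apply (ex_derive_continuous (V := R_NormedModule)).
  unfold Gamma_integrand, Rpower. auto_derive. exact ht.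
Qed.

(* The dominating function [K ^ 2 * t ^ (x - 1) / (1 + t ^ x) ^ 2] has a bounded
   antiderivative on the whole half-line, so both ends are handled at once. *)
Lemma Gamma_integrand_RInt_bounded (x : R) :
  0 < x ->
  exists M, forall a b, 0 < a -> a < b -> RInt (Gamma_integrand x) a b <= M.
Proof.
  (* [K] is chosen so that [1 + t ^ x <= K * exp (t / 2)]; squaring gives the domination. *)
  intros hx. set (K := 1 + Rpower (2 * x / 1) x).
  assert (hK : 1 < K) by (pose proof (exp_pos (x * ln (2 * x / 1))); unfold K, Rpower; lra).
  assert (hpos : forall t, 0 < Rpower t x) by (intros; apply exp_pos).
  set (g := fun t => K ^ 2 * (Rpower t x / t / (1 + Rpower t x) ^ 2)).
  set (G := fun t => - (K ^ 2 / x) / (1 + Rpower t x)).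
  assert (hG : forall t, 0 < t -> is_derive G t (g t)).
  { intros t ht. pose proof (hpos t) as hp. unfold G, g. unfold Rpower in *. auto_derive.
    - split; [exact ht|split; [lra|exact I]].
    - field. lra. }
  assert (hg : forall t, 0 < t -> continuous g t).
  { intros t ht. pose proof (hpos t) as hp.
    apply (ex_derive_continuous (V := R_NormedModule)).
    unfold g; unfold Rpower in *. auto_derive.
    repeat split; try lra.
    apply Rgt_not_eq. nra. }
  exists (K ^ 2 / x). intros a b ha hab.
  apply Rle_trans with (RInt g a b).
  - apply RInt_le; [lra| | |].
    + apply ex_RInt_pos_continuous; try lra. apply continuous_Gamma_integrand.
    + apply ex_RInt_pos_continuous; auto; lra.
    + intros t ht. assert (h0 : 0 < t) by lra. pose proof (hpos t) as hp.
      unfold Gamma_integrand, g, Rminus.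
      rewrite Rpower_plus, Rpower_Ropp, Rpower_1 by exact h0.
      assert (h1 : 1 + Rpower t x <= K * exp (t / 2)).
      { pose proof (Rpower_le_exp x 1 t hx Rlt_0_1 h0) as h.
        rewrite Rmult_1_l in h.
        assert (1 <= exp (t / 2)) by (pose proof (exp_ineq1_le (t / 2)); lra).
        unfold K. lra. }
      assert (h2 : (1 + Rpower t x) ^ 2 <= K ^ 2 * exp t).
      { replace (exp t) with (exp (t / 2) ^ 2).
        - rewrite <- Rpow_mult_distr. apply pow_incr. lra.
        - simpl. rewrite Rmult_1_r, <- exp_plus. f_equal. field. }
      rewrite exp_Ropp. pose proof (exp_pos t).
      assert (0 < (1 + Rpower t x) ^ 2) by (apply pow_lt; lra).
      replace (K ^ 2 * (Rpower t x / t / (1 + Rpower t x) ^ 2))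
        with (Rpower t x * / t * (K ^ 2 / (1 + Rpower t x) ^ 2)) by (field; lra).
      apply Rmult_le_compat_l.
      * left. apply Rmult_lt_0_compat; [exact hp|apply Rinv_0_lt_compat, h0].
      * apply Rmult_le_reg_r with (exp t * (1 + Rpower t x) ^ 2); [nra|].
        field_simplify; lra.
  (* [G] takes values between [- (K ^ 2 / x)] and 0, so no increment exceeds [K ^ 2 / x]. *)
  - rewrite (is_RInt_unique (V := R_CompleteNormedModule) g a b (G b - G a)).
    + unfold G. pose proof (hpos a); pose proof (hpos b).
      assert (hq : 0 < K ^ 2 / x) by (apply Rdiv_lt_0_compat; [apply pow_lt|]; lra).
      assert (0 < / (1 + Rpower b x)) by (apply Rinv_0_lt_compat; lra).
      assert (/ (1 + Rpower a x) <= 1)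
        by (rewrite <- Rinv_1; apply Rinv_le_contravar; lra).
      unfold Rdiv at 1 3. nra.
    + apply (is_RInt_derive (V := R_CompleteNormedModule) G g);
        intros t; rewrite Rmin_left by lra; intros ht; auto; [apply hG|apply hg]; lra.
Qed.

Lemma is_RInt_pos_Gamma (x : R) :
  0 < x -> is_RInt_pos (Gamma_integrand x) (Gamma x).
Proof.
  intros hx. destruct (Gamma_integrand_RInt_bounded x hx) as [M hM].
  destruct (ex_RInt_pos_bounded (Gamma_integrand x) M) as [l hl]; try exact hM.
  - apply continuous_Gamma_integrand.
  - intros; left; apply Gamma_integrand_pos.
  - replace (Gamma x) with l; [exact hl|]. symmetry.
    exact (is_RInt_gen_unique (V := R_CompleteNormedModule) (Gamma_integrand x) l hl).
Qed.

Lemma Gamma_pos (x : R) : 0 < x -> 0 < Gamma x.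
Proof.
  intros hx. apply Rlt_le_trans with (RInt (Gamma_integrand x) 1 2).
  - apply RInt_gt_0; [lra| |].
    + intros; apply Gamma_integrand_pos.
    + intros; apply continuous_Gamma_integrand; lra.
  - apply (is_RInt_pos_ge _ (Gamma_integrand x)); try lra.
    + apply continuous_Gamma_integrand.
    + intros; split; [left; apply Gamma_integrand_pos|apply Rle_refl].
    + apply is_RInt_pos_Gamma, hx.
Qed.

Lemma is_RInt_pos_unique (f : R -> R) (l l' : R) :
  is_RInt_pos f l -> is_RInt_pos f l' -> l = l'.
Proof.
  intros h h'.
  rewrite <- (is_RInt_gen_unique (V := R_CompleteNormedModule) f l h).
  exact (is_RInt_gen_unique (V := R_CompleteNormedModule) f l' h').
Qed.

Lemma is_RInt_pos_plus (f g : R -> R) (lf lg : R) :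
  is_RInt_pos f lf -> is_RInt_pos g lg ->
  is_RInt_pos (fun t => f t + g t) (lf + lg).
Proof. apply (is_RInt_gen_plus (V := R_NormedModule)). Qed.

Lemma is_RInt_pos_minus (f g : R -> R) (lf lg : R) :
  is_RInt_pos f lf -> is_RInt_pos g lg ->
  is_RInt_pos (fun t => f t - g t) (lf - lg).
Proof. apply (is_RInt_gen_minus (V := R_NormedModule)). Qed.

Lemma is_RInt_pos_scal (f : R -> R) (c lf : R) :
  is_RInt_pos f lf -> is_RInt_pos (fun t => c * f t) (c * lf).
Proof. apply (is_RInt_gen_scal (V := R_NormedModule)). Qed.

Lemma Gamma_succ (x : R) : 0 < x -> Gamma (x + 1) = x * Gamma x.
Proof.
  intros hx.
  assert (h : x * Gamma x - Gamma (x + 1) = 0); [|lra].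
  eapply is_RInt_pos_unique; [|apply (is_RInt_pos_Rpower_exp_derive x 1); lra].
  eapply is_RInt_pos_ext; [|apply is_RInt_pos_minus;
    [apply is_RInt_pos_scal, is_RInt_pos_Gamma, hx|apply is_RInt_pos_Gamma; lra]].
  intros t ht. unfold Gamma_integrand.
  replace (x + 1 - 1) with x by ring. rewrite !Rmult_1_l. reflexivity.
Qed.

Lemma exp_convex (l u v : R) :
  0 <= l <= 1 -> exp (l * u + (1 - l) * v) <= l * exp u + (1 - l) * exp v.
Proof.
  intros hl. set (m := l * u + (1 - l) * v).
  assert (hu := exp_ineq1_le (u - m)). assert (hv := exp_ineq1_le (v - m)).
  pose proof (exp_pos m).
  replace u with (u - m + m) at 1 by ring. replace v with (v - m + m) at 1 by ring.
  rewrite !exp_plus.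
  assert (1 <= l * exp (u - m) + (1 - l) * exp (v - m)) by (unfold m in *; nra).
  nra.
Qed.

(** Hölder's inequality in normalised form: dividing by [Gamma x] and [Gamma y] makes both integrals
    1, and the weighted AM-GM inequality [exp_convex] then applies pointwise in [t]. *)
Lemma ln_Gamma_convex (l x y : R) :
  0 <= l <= 1 -> 0 < x -> 0 < y ->
  ln (Gamma (l * x + (1 - l) * y)) <= l * ln (Gamma x) + (1 - l) * ln (Gamma y).
Proof.
  intros hl hx hy. set (z := l * x + (1 - l) * y).
  assert (hz : 0 < z) by (unfold z; nra).
  pose proof (Gamma_pos x hx) as hA; pose proof (Gamma_pos y hy) as hB.
  set (C := exp (l * ln (Gamma x) + (1 - l) * ln (Gamma y))).
  assert (hC : 0 < C) by apply exp_pos.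
  assert (h : Gamma z <= C * (l / Gamma x * Gamma x + (1 - l) / Gamma y * Gamma y)).
  { eapply (is_RInt_pos_le (Gamma_integrand z)); [|apply is_RInt_pos_Gamma, hz|
      apply is_RInt_pos_scal, is_RInt_pos_plus;
      apply is_RInt_pos_scal, is_RInt_pos_Gamma; assumption].
    intros t ht. split; [left; apply Gamma_integrand_pos|].
    simpl.
    assert (e : forall w, Gamma_integrand w t = exp ((w - 1) * ln t - t))
      by (intros; unfold Gamma_integrand, Rpower; rewrite <- exp_plus; reflexivity).
    rewrite !e.
    assert (ex : exp (- ln (Gamma x)) = / Gamma x)
      by (rewrite exp_Ropp, exp_ln by assumption; reflexivity).
    assert (ey : exp (- ln (Gamma y)) = / Gamma y)
      by (rewrite exp_Ropp, exp_ln by assumption; reflexivity).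
    unfold Rdiv. rewrite <- ex, <- ey.
    rewrite (Rmult_assoc l), (Rmult_assoc (1 - l)), <- !exp_plus.
    replace ((z - 1) * ln t - t) with
      (l * ln (Gamma x) + (1 - l) * ln (Gamma y) +
       (l * (- ln (Gamma x) + ((x - 1) * ln t - t))
        + (1 - l) * (- ln (Gamma y) + ((y - 1) * ln t - t)))) by (unfold z; ring).
    rewrite exp_plus. apply Rmult_le_compat_l; [left; exact hC|].
    apply exp_convex, hl. }
  replace (C * (l / Gamma x * Gamma x + (1 - l) / Gamma y * Gamma y)) with C in h
    by (field; lra).
  rewrite <- (ln_exp (l * ln (Gamma x) + (1 - l) * ln (Gamma y))).
  apply ln_le; [apply Gamma_pos, hz|exact h].
Qed.

Lemma ln_Gamma_succ (x : R) : 0 < x -> ln (Gamma (x + 1)) = ln x + ln (Gamma x).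
Proof.
  intros hx. rewrite Gamma_succ by exact hx. apply ln_mult; [exact hx|].
  apply Gamma_pos, hx.
Qed.

(* Compares the slope of the convex function [ln Gamma] on [[y, y + x]] with its
   slopes on the adjacent unit intervals. *)
Lemma ln_Gamma_increment (x y : R) :
  0 < x -> 1 < y ->
  x * ln (y - 1) <= ln (Gamma (y + x)) - ln (Gamma y) <= x * ln (y + x).
Proof.
  intros hx hy.
  assert (hi : 0 < / (1 + x)) by (apply Rinv_0_lt_compat; lra).
  assert (hi1 : / (1 + x) * (1 + x) = 1) by (field; lra).
  assert (hl : 0 <= / (1 + x) <= 1) by nra.
  split.
  - pose proof (ln_Gamma_convex (/ (1 + x)) (y + x) (y - 1) hl
                  ltac:(lra) ltac:(lra)) as h.
    replace (/ (1 + x) * (y + x) + (1 - / (1 + x)) * (y - 1)) with y in h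
      by (field; lra).
    pose proof (ln_Gamma_succ (y - 1) ltac:(lra)) as e.
    replace (y - 1 + 1) with y in e by ring.
    apply (Rmult_le_compat_l (1 + x)) in h; [|lra].
    replace ((1 + x) * (/ (1 + x) * ln (Gamma (y + x))
             + (1 - / (1 + x)) * ln (Gamma (y - 1))))
      with (ln (Gamma (y + x)) + x * ln (Gamma (y - 1))) in h by (field; lra).
    nra.
  - pose proof (ln_Gamma_convex (/ (1 + x)) y (y + x + 1) hl
                  ltac:(lra) ltac:(lra)) as h.
    replace (/ (1 + x) * y + (1 - / (1 + x)) * (y + x + 1)) with (y + x) in h
      by (field; lra).
    pose proof (ln_Gamma_succ (y + x) ltac:(lra)) as e.
    apply (Rmult_le_compat_l (1 + x)) in h; [|lra].
    replace ((1 + x) * (/ (1 + x) * ln (Gamma y)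
             + (1 - / (1 + x)) * ln (Gamma (y + x + 1))))
      with (ln (Gamma y) + x * ln (Gamma (y + x + 1))) in h by (field; lra).
    nra.
Qed.

(** * Gauss's product and the polygamma series *)

(** Logarithm of the factor [(1 + 1/j)^x / (1 + x/j)], [j = n + 1], in Euler's form of the product
    for [Gamma (x + 1)]. *)
Definition gauss_term (x : R) (n : nat) : R :=
  x * (ln (INR (S (S n))) - ln (INR (S n))) - (ln (x + INR (S n)) - ln (INR (S n))).

Lemma INR_S_pos (n : nat) : 0 < INR (S n).
Proof. apply lt_0_INR. lia. Qed.

(** Adding 1 to the argument changes [ln Gamma] by a logarithm, at [j] and at [j + x] alike, so the
    sum telescopes to an increment of [ln Gamma] over an interval of length [x]. *)
Lemma sum_gauss_term (x : R) (n : nat) :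
  0 < x ->
  sum_n (gauss_term x) n =
    x * ln (INR (S (S n)))
    - (ln (Gamma (INR (S (S n)) + x)) - ln (Gamma (INR (S (S n)))))
    + (ln (Gamma (x + 1)) - ln (Gamma 1)) :> R.
Proof.
  intros hx.
  assert (hstep : forall m, ln (Gamma (INR (S (S m)) + x)) - ln (Gamma (INR (S (S m))))
     = ln (x + INR (S m)) - ln (INR (S m))
       + (ln (Gamma (INR (S m) + x)) - ln (Gamma (INR (S m))))).
  { intros m. pose proof (INR_S_pos m) as hm. rewrite (S_INR (S m)).
    rewrite (ln_Gamma_succ (INR (S m))) by exact hm.
    replace (INR (S m) + 1 + x) with (x + INR (S m) + 1) by ring.
    rewrite ln_Gamma_succ by lra. rewrite (Rplus_comm (INR (S m)) x). ring. }
  induction n as [|n IH].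
  - rewrite sum_O, hstep. unfold gauss_term. change (INR 1) with 1.
    rewrite ln_1, (Rplus_comm 1 x). ring.
  - rewrite sum_Sn, IH, (hstep (S n)). unfold gauss_term.
    change plus with Rplus. ring.
Qed.

Lemma ln_diff_bounds (a b : R) :
  0 < a -> 0 < b -> (b - a) / b <= ln b - ln a <= (b - a) / a.
Proof.
  assert (h : forall u v, 0 < u -> 0 < v -> ln v - ln u <= (v - u) / u).
  { intros u v hu hv. rewrite <- ln_div by assumption.
    pose proof (exp_ineq1_le (ln (v / u))) as h.
    rewrite exp_ln in h by (apply Rdiv_lt_0_compat; assumption).
    replace ((v - u) / u) with (v / u - 1) by (field; lra). lra. }
  intros ha hb. split; [|apply h; assumption].
  pose proof (h b a hb ha).
  replace ((b - a) / b) with (- ((a - b) / b)) by (field; lra). lra.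
Qed.

Lemma is_lim_seq_INR_S : is_lim_seq (fun n => INR (S n)) p_infty.
Proof. apply -> is_lim_seq_incr_1. apply is_lim_seq_INR. Qed.

Lemma is_lim_seq_inv_INR_S (c : R) : is_lim_seq (fun n => c / INR (S n)) 0.
Proof.
  replace (Finite 0) with (Rbar_mult c 0) by (simpl; f_equal; ring).
  apply (is_lim_seq_scal_l (fun n => / INR (S n))).
  apply (is_lim_seq_inv _ p_infty); [apply is_lim_seq_INR_S|discriminate].
Qed.

Lemma is_series_gauss_term (x : R) :
  0 < x -> is_series (gauss_term x) (ln (Gamma (x + 1)) - ln (Gamma 1)).
Proof.
  intros hx. set (L := ln (Gamma (x + 1)) - ln (Gamma 1)).
  change (is_lim_seq (sum_n (gauss_term x)) L).
  assert (h0 : is_lim_seq (fun n => L - x * x / INR (S (S n))) (L - 0)).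
  { apply is_lim_seq_minus'; [apply is_lim_seq_const|].
    apply -> (is_lim_seq_incr_1 (fun n => x * x / INR (S n))).
    apply is_lim_seq_inv_INR_S. }
  assert (h1 : is_lim_seq (fun n => L + x / INR (S n)) (L + 0)).
  { apply is_lim_seq_plus'; [apply is_lim_seq_const|apply is_lim_seq_inv_INR_S]. }
  rewrite Rminus_0_r in h0. rewrite Rplus_0_r in h1.
  refine (is_lim_seq_le_le _ _ _ _ _ h0 h1). intros n.
  rewrite sum_gauss_term by exact hx. fold L.
  pose proof (INR_S_pos n) as hn. rewrite (S_INR (S n)).
  set (y := INR (S n)) in *.
  (* The error is [x * ln (y + 1)] minus the increment of [ln Gamma] over [[y + 1, y + 1 + x]];
     convexity puts it between [- x * x / (y + 1)] and [x / y]. *)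
  destruct (ln_Gamma_increment x (y + 1) hx ltac:(lra)) as [hl hu].
  replace (y + 1 - 1) with y in hl by ring.
  destruct (ln_diff_bounds y (y + 1) ltac:(lra) ltac:(lra)) as [_ h2].
  destruct (ln_diff_bounds (y + 1) (y + 1 + x) ltac:(lra) ltac:(lra)) as [_ h3].
  replace (y + 1 - y) with 1 in h2 by ring.
  replace (y + 1 + x - (y + 1)) with x in h3 by ring.
  split.
  - apply (Rmult_le_compat_l x) in h3; [|lra].
    replace (x * (x / (y + 1))) with (x * x / (y + 1)) in h3 by (field; lra). nra.
  - apply (Rmult_le_compat_l x) in h2; [|lra].
    replace (x * (1 / y)) with (x / y) in h2 by (field; lra). nra.
Qed.

(** * Convergence and termwise differentiation of series *)

Lemma is_series_telescope (u : nat -> R) :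
  is_lim_seq u 0 -> is_series (fun n => u n - u (S n)) (u O).
Proof.
  intros hu. change (is_lim_seq (sum_n (fun n => u n - u (S n))) (u O)).
  apply (is_lim_seq_ext (fun n => u O - u (S n))).
  - induction n as [|n IH]; [rewrite sum_O; reflexivity|].
    rewrite sum_Sn, <- IH. change plus with Rplus. ring.
  - replace (Finite (u O)) with (Finite (u O - 0)) by (f_equal; ring).
    apply is_lim_seq_minus'; [apply is_lim_seq_const|].
    apply -> is_lim_seq_incr_1. exact hu.
Qed.

(** For [j >= 1], [2 / j - 2 / (j + 1) = 2 / (j * (j + 1)) >= 1 / j ^ 2], so a telescoping series
    dominates. *)
Lemma ex_series_inv_sqr (c : R) : ex_series (fun n => c * (/ INR (S n)) ^ 2).
Proof.
  apply (ex_series_scal_l (K := R_AbsRing) (V := R_NormedModule) c (fun n => (/ INR (S n)) ^ 2)).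
  apply (ex_series_le (V := R_CompleteNormedModule) _
           (fun n => 2 / INR (S n) - 2 / INR (S (S n)))).
  - intros n. pose proof (INR_S_pos n) as hn.
    assert (h1 : 1 <= INR (S n)) by (apply (le_INR 1); lia).
    rewrite (S_INR (S n)). set (y := INR (S n)) in *.
    change (Rabs ((/ y) ^ 2) <= 2 / y - 2 / (y + 1)).
    assert (hi : 0 < / y) by (apply Rinv_0_lt_compat, hn).
    rewrite Rabs_pos_eq by (apply pow_le; lra).
    replace (2 / y - 2 / (y + 1)) with ((/ y) ^ 2 + (y - 1) * ((/ y) ^ 2 * / (y + 1)))
      by (field; lra).
    assert (0 <= (y - 1) * ((/ y) ^ 2 * / (y + 1))); [|lra].
    apply Rmult_le_pos; [lra|]. apply Rmult_le_pos; [apply pow_le; lra|].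
    left; apply Rinv_0_lt_compat; lra.
  - eexists. apply is_series_telescope, is_lim_seq_inv_INR_S.
Qed.

(** Weierstrass M-test: the remainders of the derived series are bounded by those of [M], uniformly
    on [(a, b)]. *)
Lemma is_derive_Series (f f' : nat -> R -> R) (M : nat -> R) (a b x : R) :
  a < x < b ->
  (forall n y, a < y < b -> is_derive (f n) y (f' n y)) ->
  (forall n y, a < y < b -> continuous (f' n) y) ->
  (forall n y, a < y < b -> Rabs (f' n y) <= M n) ->
  ex_series M ->
  (forall y, a < y < b -> ex_series (fun n => f n y)) ->
  is_derive (fun y => Series (fun n => f n y)) x (Series (fun n => f' n x)).
Proof.
  intros hx hd hc hb hM hs.
  assert (hr : 0 < (b - a) / 2) by lra.
  (* [CVU] speaks of balls, hence the midpoint and the half-length of the interval. *)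
  set (r := mkposreal _ hr). set (c := (a + b) / 2).
  assert (hB : forall y, Boule c r y -> a < y < b).
  { intros y hy. unfold Boule in hy. simpl in hy. apply Rabs_def2 in hy.
    unfold c in hy. lra. }
  assert (hBx : Boule c r x).
  { unfold Boule. simpl. unfold c. apply Rabs_def1; lra. }
  assert (hs' : forall y, a < y < b -> ex_series (fun n => f' n y)).
  { intros y hy. apply (ex_series_le (V := R_CompleteNormedModule) _ M); [|exact hM].
    intros n. apply hb, hy. }
  assert (hCVU : CVU (fun n y => sum_n (fun i => f' i y) n)
                     (fun y => Series (fun i => f' i y)) c r).
  { intros eps heps.
    assert (hlM : is_lim_seq (sum_n M) (Series M)) by exact (Series_correct M hM).
    destruct (proj2 (is_lim_seq_spec _ _) hlM (mkposreal _ heps)) as [N hN].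
    exists N. intros n y hn hy. apply hB in hy. specialize (hN n hn). simpl in hN.
    assert (e : forall g, ex_series g ->
      Series g - sum_n g n = Series (fun k => g (S n + k)%nat)).
    { intros g hg. rewrite (Series_incr_n g (S n)) by (auto; lia).
      simpl Init.Nat.pred. rewrite sum_n_Reals. ring. }
    rewrite e by (apply hs', hy). rewrite Rabs_minus_sym, e in hN by exact hM.
    apply Rle_lt_trans with (2 := hN). apply Rle_trans with (2 := Rle_abs _).
    assert (hMn : ex_series (fun k => M (S n + k)%nat))
      by (apply (ex_series_incr_n M), hM).
    apply Rle_trans with (Series (fun k => Rabs (f' (S n + k)%nat y))).
    - apply Series_Rabs.
      apply (ex_series_le (V := R_CompleteNormedModule) _ (fun k => M (S n + k)%nat));
        [|exact hMn].
      intros k. change (Rabs (Rabs (f' (S n + k)%nat y)) <= M (S n + k)%nat).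
      rewrite Rabs_Rabsolu. apply hb, hy.
    - apply Series_le; [|exact hMn]. intros k. split; [apply Rabs_pos|apply hb, hy]. }
  apply is_derive_Reals.
  apply (derivable_pt_lim_CVU (fun n y => sum_n (fun i => f i y) n)
           (fun n y => sum_n (fun i => f' i y) n) _
           (fun y => Series (fun i => f' i y)) x c r hBx).
  - intros y n hy. apply is_derive_Reals.
    apply (is_derive_sum_n (fun i => f i) n y (fun i => f' i y)).
    intros k _. apply hd, hB, hy.
  - intros y hy. apply is_lim_seq_Reals. apply Series_correct, hs, hB, hy.
  - exact hCVU.
  - apply (CVU_continuity _ _ _ _ hCVU). intros n y hy.
    apply continuity_pt_filterlim.
    induction n as [|n IH].
    + apply (continuous_ext (f' O)); [intros; rewrite sum_O; reflexivity|].
      apply hc, hB, hy.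
    + apply (continuous_ext (fun z => plus (sum_n (fun i => f' i z) n) (f' (S n) z)));
        [intros; rewrite sum_Sn; reflexivity|].
      apply (continuous_plus (V := R_NormedModule)); [exact IH|apply hc, hB, hy].
Qed.

Lemma inv_add_INR_S_bounds (y : R) (n : nat) :
  0 < y -> 0 < / (y + INR (S n)) < 1 /\ (/ (y + INR (S n))) ^ 2 <= (/ INR (S n)) ^ 2.
Proof.
  intros hy. assert (h1 : 1 <= INR (S n)) by (apply (le_INR 1); lia).
  assert (h : 0 < / (y + INR (S n))) by (apply Rinv_0_lt_compat; lra).
  split; [split; [exact h|]|].
  - rewrite <- Rinv_1. apply Rinv_lt_contravar; lra.
  - apply pow_incr. split; [lra|]. apply Rinv_le_contravar; lra.
Qed.

(** The base lies in [(0, 1)], so exponents above 2 only decrease the power: one inverse-square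
    majorant serves all derivatives, uniformly in [y > 0]. *)
Lemma inv_pow_le_inv_sqr (m n : nat) (y : R) :
  (2 <= m)%nat -> 0 < y ->
  0 < (/ (y + INR (S n))) ^ m <= (/ INR (S n)) ^ 2.
Proof.
  intros hm hy. destruct (inv_add_INR_S_bounds y n hy) as [[h0 h1] h2].
  split; [apply pow_lt, h0|].
  apply Rle_trans with (2 := h2).
  replace m with (2 + (m - 2))%nat by lia. rewrite pow_add.
  rewrite <- (Rmult_1_r ((/ (y + INR (S n))) ^ 2)) at 2.
  apply Rmult_le_compat_l; [apply pow_le; lra|].
  rewrite <- (pow1 (m - 2)). apply pow_incr. lra.
Qed.

(** The Hurwitz zeta value [zeta(m, x + 1)]. The term [1/x^m] is left out so that the function
    extends to [x = 0], where it determines the lower constant. *)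
Definition hurwitz_tail (m : nat) (x : R) : R :=
  Series (fun n => (/ (x + INR (S n))) ^ m).

Lemma ex_series_hurwitz_tail (m : nat) (y : R) :
  (2 <= m)%nat -> 0 <= y -> ex_series (fun n => (/ (y + INR (S n))) ^ m).
Proof.
  intros hm [hy|<-].
  - apply (ex_series_le (V := R_CompleteNormedModule) _ (fun n => 1 * (/ INR (S n)) ^ 2));
      [|apply ex_series_inv_sqr].
    intros n. destruct (inv_pow_le_inv_sqr m n y hm hy).
    change (Rabs ((/ (y + INR (S n))) ^ m) <= 1 * (/ INR (S n)) ^ 2).
    rewrite Rabs_pos_eq; lra.
  - apply (ex_series_le (V := R_CompleteNormedModule) _ (fun n => 1 * (/ INR (S n)) ^ 2));
      [|apply ex_series_inv_sqr].
    intros n. assert (h1 : 1 <= INR (S n)) by (apply (le_INR 1); lia).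
    assert (h : 0 < / INR (S n)) by (apply Rinv_0_lt_compat; lra).
    assert (h' : / INR (S n) <= 1) by (rewrite <- Rinv_1; apply Rinv_le_contravar; lra).
    change (Rabs ((/ (0 + INR (S n))) ^ m) <= 1 * (/ INR (S n)) ^ 2).
    rewrite Rplus_0_l, Rabs_pos_eq by (apply pow_le; lra).
    replace m with ((m - 2) + 2)%nat by lia. rewrite pow_add.
    apply Rmult_le_compat_r; [apply pow_le; lra|].
    rewrite <- (pow1 (m - 2)). apply pow_incr. lra.
Qed.

Lemma is_derive_hurwitz_tail (m : nat) (x : R) :
  (2 <= m)%nat -> 0 < x ->
  is_derive (hurwitz_tail m) x (- INR m * hurwitz_tail (S m) x).
Proof.
  intros hm hx.
  unfold hurwitz_tail at 2. rewrite <- Series_scal_l.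
  apply (is_derive_Series (fun n y => (/ (y + INR (S n))) ^ m)
           (fun n y => - INR m * (/ (y + INR (S n))) ^ S m)
           (fun n => INR m * (/ INR (S n)) ^ 2) 0 (x + 1)); [lra| | | | |].
  - intros n y hy. pose proof (INR_S_pos n) as hj.
    revert hj. generalize (INR (S n)). intros j hj.
    auto_derive; [lra|]. destruct m as [|m]; [lia|].
    change (Init.Nat.pred (S m)) with m. rewrite <- !tech_pow_Rmult. field. lra.
  - intros n y hy. pose proof (INR_S_pos n) as hj.
    revert hj. generalize (INR (S n)). intros j hj.
    apply (ex_derive_continuous (V := R_NormedModule)). auto_derive. lra.
  - intros n y hy. rewrite Rabs_mult, Rabs_Ropp, Rabs_pos_eq by apply pos_INR.
    destruct (inv_pow_le_inv_sqr (S m) n y ltac:(lia) (proj1 hy)).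
    rewrite Rabs_pos_eq by lra. apply Rmult_le_compat_l; [apply pos_INR|lra].
  - apply ex_series_inv_sqr.
  - intros y hy. apply ex_series_hurwitz_tail; [exact hm|lra].
Qed.

(** The derivative of [gauss_term] in [x]. With the logarithmic difference in place of [1/(n + 1)],
    Euler's constant is absorbed into the series for [psi]. *)
Definition psi_term (x : R) (n : nat) : R :=
  ln (INR (S (S n))) - ln (INR (S n)) - / (x + INR (S n)).

(** With [j = n + 1], the logarithmic difference lies between [/ (j + 1)] and [/ j], and each of
    these differs from [/ (x + j)] by at most [(1 + x) / j ^ 2]. *)
Lemma Rabs_psi_term_le (x : R) (n : nat) :
  0 < x -> Rabs (psi_term x n) <= (1 + x) * (/ INR (S n)) ^ 2.
Proof.
  intros hx. unfold psi_term. rewrite (S_INR (S n)).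
  assert (h1 : 1 <= INR (S n)) by (apply (le_INR 1); lia).
  set (j := INR (S n)) in *.
  destruct (ln_diff_bounds j (j + 1) ltac:(lra) ltac:(lra)) as [hl hu].
  replace (j + 1 - j) with 1 in hl, hu by ring.
  assert (hj : 0 < / j) by (apply Rinv_0_lt_compat; lra).
  assert (hj1 : 0 < / (j + 1) <= / j)
    by (split; [apply Rinv_0_lt_compat; lra|apply Rinv_le_contravar; lra]).
  assert (hxj : 0 < / (x + j) <= / j)
    by (split; [apply Rinv_0_lt_compat; lra|apply Rinv_le_contravar; lra]).
  assert (e1 : / j - / (x + j) = x * (/ j * / (x + j))) by (field; lra).
  assert (e2 : / (x + j) - / (j + 1) = (1 - x) * (/ (x + j) * / (j + 1))) by (field; lra).
  assert (b1 : 0 <= / j * / (x + j) <= (/ j) ^ 2) by (split; simpl; nra).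
  assert (b2 : 0 <= / (x + j) * / (j + 1) <= (/ j) ^ 2) by (split; simpl; nra).
  apply Rabs_le. split; nra.
Qed.

Lemma ex_series_psi_term (x : R) : 0 < x -> ex_series (psi_term x).
Proof.
  intros hx.
  apply (ex_series_le (V := R_CompleteNormedModule) _ (fun n => (1 + x) * (/ INR (S n)) ^ 2)).
  - intros n. apply Rabs_psi_term_le, hx.
  - apply ex_series_inv_sqr.
Qed.

(** Differentiation acts on the exponential of the series, not on the improper integral; the factor
    [Gamma x] reappears, so the bracket is [psi x]. *)
Lemma is_derive_Gamma (x : R) :
  0 < x -> is_derive Gamma x (Gamma x * (- / x + Series (psi_term x))).
Proof.
  intros hx.
  assert (hG : forall y, 0 < y ->
    Gamma y = exp (ln (Gamma 1) - ln y + Series (gauss_term y))).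
  { intros y hy. rewrite (is_series_unique _ _ (is_series_gauss_term y hy)).
    rewrite ln_Gamma_succ by exact hy.
    replace (ln (Gamma 1) - ln y + (ln y + ln (Gamma y) - ln (Gamma 1)))
      with (ln (Gamma y)) by ring.
    rewrite exp_ln; [reflexivity|apply Gamma_pos, hy]. }
  assert (hS : is_derive (fun y => Series (gauss_term y)) x (Series (psi_term x))).
  { apply (is_derive_Series (fun n y => gauss_term y n) (fun n y => psi_term y n)
             (fun n => (1 + (x + 1)) * (/ INR (S n)) ^ 2) 0 (x + 1)); [lra| | | | |].
    - intros n y hy. pose proof (INR_S_pos n) as hj.
      unfold gauss_term, psi_term.
      revert hj. generalize (INR (S n)) (INR (S (S n))). intros j j' hj.
      auto_derive; [lra|]. field. lra.
    - intros n y hy. pose proof (INR_S_pos n) as hj. unfold psi_term.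
      revert hj. generalize (INR (S n)) (INR (S (S n))). intros j j' hj.
      apply (ex_derive_continuous (V := R_NormedModule)).
      auto_derive. lra.
    - intros n y hy. apply Rle_trans with (1 := Rabs_psi_term_le y n (proj1 hy)).
      apply Rmult_le_compat_r; [|lra]. apply pow_le.
      left; apply Rinv_0_lt_compat, INR_S_pos.
    - apply ex_series_inv_sqr.
    - intros y hy. eexists. apply is_series_gauss_term, hy. }
  apply (is_derive_ext_loc (fun y => exp (ln (Gamma 1) - ln y + Series (gauss_term y)))).
  - apply (filter_imp (fun u => 0 < u)); [intros u hu; symmetry; apply hG, hu|].
    apply (open_gt 0). exact hx.
  - rewrite (hG x hx).
    apply is_derive_Reals. apply is_derive_Reals in hS.
    apply (derivable_pt_lim_comp (fun y => ln (Gamma 1) - ln y + Series (gauss_term y)) exp)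
      with (l1 := - / x + Series (psi_term x)).
    + apply derivable_pt_lim_plus; [|exact hS].
      apply is_derive_Reals. auto_derive; [exact hx|]. ring.
    + apply derivable_pt_lim_exp.
Qed.

Lemma psi_series (x : R) : 0 < x -> psi x = - / x + Series (psi_term x).
Proof.
  intros hx. unfold psi. rewrite (is_derive_unique _ _ _ (is_derive_Gamma x hx)).
  field. split; [lra|]. apply Rgt_not_eq, Gamma_pos, hx.
Qed.

Lemma polygamma_1 (x : R) :
  0 < x -> polygamma 1 x = (/ x) ^ 2 + hurwitz_tail 2 x.
Proof.
  intros hx. unfold polygamma. simpl Derive_n.
  rewrite (Derive_ext_loc _ (fun y => - / y + Series (psi_term y))).
  2: { apply (filter_imp (fun u => 0 < u)); [intros u hu; apply psi_series, hu|].
       apply (open_gt 0). exact hx. }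
  apply is_derive_unique.
  apply (is_derive_plus (V := R_NormedModule)).
  - auto_derive; [lra|]. field. lra.
  - apply (is_derive_Series (fun n y => psi_term y n)
             (fun n y => (/ (y + INR (S n))) ^ 2)
             (fun n => 1 * (/ INR (S n)) ^ 2) 0 (x + 1)); [lra| | | | |].
    + intros n y hy. pose proof (INR_S_pos n) as hj.
      unfold psi_term.
      revert hj. generalize (INR (S n)) (INR (S (S n))). intros j j' hj.
      auto_derive; [lra|]. field. lra.
    + intros n y hy. pose proof (INR_S_pos n) as hj.
      revert hj. generalize (INR (S n)). intros j hj.
      apply (ex_derive_continuous (V := R_NormedModule)). auto_derive. lra.
    + intros n y hy. destruct (inv_pow_le_inv_sqr 2 n y ltac:(lia) (proj1 hy)).
      rewrite Rabs_pos_eq; lra.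
    + apply ex_series_inv_sqr.
    + intros y hy. apply ex_series_psi_term, hy.
Qed.

Lemma polygamma_series (k : nat) (x : R) :
  0 < x ->
  polygamma (S k) x =
    (-1) ^ k * INR (fact (S k)) * ((/ x) ^ (S (S k)) + hurwitz_tail (S (S k)) x).
Proof.
  revert x. induction k as [|k IH]; intros x hx.
  - rewrite polygamma_1 by exact hx. simpl. ring.
  - unfold polygamma. change (Derive (polygamma (S k)) x =
      (-1) ^ S k * INR (fact (S (S k)))
        * ((/ x) ^ S (S (S k)) + hurwitz_tail (S (S (S k))) x)).
    rewrite (Derive_ext_loc _ (fun y => (-1) ^ k * INR (fact (S k))
               * ((/ y) ^ (S (S k)) + hurwitz_tail (S (S k)) y))).
    2: { apply (filter_imp (fun u => 0 < u)); [intros u hu; apply IH, hu|].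
         apply (open_gt 0). exact hx. }
    apply is_derive_unique.
    replace ((-1) ^ S k * INR (fact (S (S k)))
        * ((/ x) ^ S (S (S k)) + hurwitz_tail (S (S (S k))) x))
      with ((-1) ^ k * INR (fact (S k)) *
            (- INR (S (S k)) * (/ x) ^ S (S (S k)) +
             - INR (S (S k)) * hurwitz_tail (S (S (S k))) x)).
    + apply is_derive_scal. apply (is_derive_plus (V := R_NormedModule)).
      * generalize (S (S k)). intros m. auto_derive; [lra|].
        destruct m as [|m]; [simpl; ring|].
        change (Init.Nat.pred (S m)) with m.
        rewrite <- !tech_pow_Rmult. field. lra.
      * apply is_derive_hurwitz_tail; [lia|exact hx].
    + replace (fact (S (S k))) with (S (S k) * fact (S k))%nat by reflexivity.
      rewrite mult_INR, <- (tech_pow_Rmult (-1) k). ring.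
Qed.

(** * Comparison of series and the absolute value of [polygamma] *)

Lemma Series_pos (a : nat -> R) :
  (forall n, 0 < a n) -> ex_series a -> 0 < Series a.
Proof.
  intros hp ha. rewrite Series_incr_1 by exact ha.
  apply (ex_series_incr_1 a) in ha.
  assert (h : Series (fun n => 0 * a (S n)) <= Series (fun n => a (S n))).
  { apply Series_le; [|exact ha]. intros n. pose proof (hp (S n)). lra. }
  rewrite Series_scal_l in h. pose proof (hp O). lra.
Qed.

(** Terms of either sign are allowed: the telescoping minorant in [hurwitz_tail_ge] has negative
    terms for small [x]. *)
Lemma Series_mono (a b : nat -> R) :
  (forall n, a n <= b n) -> ex_series a -> ex_series b -> Series a <= Series b.
Proof.
  intros h ha hb.
  assert (hd : ex_series (fun n => b n - a n))
    by apply (ex_series_minus (V := R_NormedModule) b a hb ha).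
  assert (h0 : Series (fun n => 0 * (b n - a n)) <= Series (fun n => b n - a n)).
  { apply Series_le; [|exact hd]. intros n. pose proof (h n). lra. }
  rewrite Series_scal_l, Series_minus in h0 by assumption. lra.
Qed.

Lemma Series_lt (a b : nat -> R) :
  (forall n, a n < b n) -> ex_series a -> ex_series b -> Series a < Series b.
Proof.
  intros h ha hb.
  assert (0 < Series (fun n => b n - a n)).
  { apply Series_pos; [intros n; pose proof (h n); lra|].
    apply (ex_series_minus (V := R_NormedModule) b a hb ha). }
  rewrite Series_minus in H by assumption. lra.
Qed.

Lemma hurwitz_tail_pos (m : nat) (x : R) :
  (2 <= m)%nat -> 0 <= x -> 0 < hurwitz_tail m x.
Proof.
  intros hm hx. apply Series_pos; [|apply ex_series_hurwitz_tail; assumption].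
  intros n. pose proof (INR_S_pos n). apply pow_lt, Rinv_0_lt_compat. lra.
Qed.

Lemma Rabs_polygamma (k : nat) (x : R) :
  (1 <= k)%nat -> 0 < x ->
  Rabs (polygamma k x) =
    INR (fact k) * hurwitz_tail (S k) x + INR (fact k) / x ^ (k + 1).
Proof.
  intros hk hx. destruct k as [|k]; [lia|].
  rewrite polygamma_series by exact hx.
  rewrite Rmult_assoc, Rabs_mult, pow_1_abs, Rmult_1_l.
  pose proof (hurwitz_tail_pos (S (S k)) x ltac:(lia) ltac:(lra)).
  assert (0 < / x) by (apply Rinv_0_lt_compat, hx).
  assert (0 < (/ x) ^ S (S k)) by (apply pow_lt; assumption).
  pose proof (INR_fact_lt_0 (S k)).
  rewrite Rabs_pos_eq by (apply Rmult_le_pos; lra).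
  replace (S k + 1)%nat with (S (S k)) by lia.
  unfold Rdiv. rewrite pow_inv. ring.
Qed.

(** At [x = 1] the isolated term [1 / x ^ (k + 1)] equals the first term of the series at 0. This
    turns the lower constant into a condition at [x = 0]. *)
Lemma Rabs_polygamma_at_1 (k : nat) :
  (1 <= k)%nat ->
  Rabs (polygamma k 1) = INR (fact k) * hurwitz_tail (S k) 0.
Proof.
  intros hk. rewrite Rabs_polygamma by (auto; lra). unfold hurwitz_tail at 2.
  rewrite Series_incr_1 by (apply ex_series_hurwitz_tail; [lia|lra]).
  unfold hurwitz_tail.
  rewrite (Series_ext (fun n => (/ (0 + INR (S (S n)))) ^ S k)
                      (fun n => (/ (1 + INR (S n))) ^ S k)).
  - change (INR 1) with 1. rewrite Rplus_0_l, Rinv_1, !pow1. field.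
  - intros n. rewrite (S_INR (S n)). f_equal. f_equal. ring.
Qed.

(** * Estimates of the polygamma tail *)

(** The two inequalities feed each other: one more factor turns the difference [D] and the sum [S]
    into [D + e * S] and [S + e * D]. *)
Lemma pow_add_sub_ge (k : nat) (e : R) :
  0 <= e <= 1 ->
  2 * INR k * e <= (1 + e) ^ k - (1 - e) ^ k /\ 2 <= (1 + e) ^ k + (1 - e) ^ k.
Proof.
  intros he. induction k as [|k [IH1 IH2]].
  - simpl. lra.
  - rewrite S_INR. pose proof (pos_INR k). simpl pow. split; nra.
Qed.

(** Midpoint rule for the convex function [k / s^(k+1)] on [[y - 1/2, y + 1/2]]. Scaling by [y],
    with [e = 1/(2y)], leaves a quotient whose numerator [(1+e)^k - (1-e)^k] is at least [2ke] and
    whose denominator [(1-e^2)^k] is below 1, whence strictness. *)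
Lemma inv_pow_midpoint (k : nat) (y : R) :
  (1 <= k)%nat -> 1 / 2 < y ->
  INR k * (/ y) ^ S k < (/ (y - 1 / 2)) ^ k - (/ (y + 1 / 2)) ^ k.
Proof.
  intros hk hy. set (e := / (2 * y)).
  assert (he : 0 < e < 1).
  { unfold e. split; [apply Rinv_0_lt_compat; lra|].
    rewrite <- Rinv_1. apply Rinv_lt_contravar; lra. }
  assert (hkR : 1 <= INR k) by (apply (le_INR 1); exact hk).
  assert (e1 : / (y - 1 / 2) = / y * / (1 - e)) by (unfold e; field; lra).
  assert (e2 : / (y + 1 / 2) = / y * / (1 + e)) by (unfold e; field; lra).
  rewrite e1, e2, !Rpow_mult_distr, <- Rmult_minus_distr_l.
  replace (INR k * (/ y) ^ S k) with ((/ y) ^ k * (2 * INR k * e))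
    by (rewrite <- tech_pow_Rmult; unfold e; field; lra).
  apply Rmult_lt_compat_l; [apply pow_lt, Rinv_0_lt_compat; lra|].
  rewrite !pow_inv.
  assert (ha : 0 < (1 - e) ^ k) by (apply pow_lt; lra).
  assert (hb : 0 < (1 + e) ^ k) by (apply pow_lt; lra).
  assert (hab : (1 - e) ^ k * (1 + e) ^ k < 1).
  { rewrite <- Rpow_mult_distr. apply pow_lt_1_compat; [nra|lia]. }
  destruct (pow_add_sub_ge k e ltac:(lra)) as [h _].
  set (a := (1 - e) ^ k) in *. set (b := (1 + e) ^ k) in *.
  apply Rmult_lt_reg_r with (a * b); [nra|].
  replace ((/ a - / b) * (a * b)) with (b - a) by (field; lra).
  assert (hm : 0 < 2 * INR k * e) by nra.
  apply (Rmult_lt_compat_l _ _ _ hm) in hab. lra.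
Qed.

(** Trapezoidal rule for the same function on [[y, y + 1]], made algebraic by the identity
    [a * b = a - b] for the two reciprocals. *)
Lemma inv_pow_trapezoid (k : nat) (y : R) :
  0 < y ->
  (/ y) ^ k - (/ (y + 1)) ^ k <= INR k / 2 * ((/ y) ^ S k + (/ (y + 1)) ^ S k).
Proof.
  intros hy.
  assert (hab : / y * / (y + 1) = / y - / (y + 1)) by (field; lra).
  assert (hb : 0 < / (y + 1)) by (apply Rinv_0_lt_compat; lra).
  assert (ha : / (y + 1) <= / y) by (apply Rinv_le_contravar; lra).
  set (a := / y) in *. set (b := / (y + 1)) in *.
  induction k as [|k IH]; [simpl; lra|].
  rewrite S_INR. rewrite <- !tech_pow_Rmult in *.
  pose proof (pos_INR k) as hk.
  assert (hA : 0 < b ^ k) by (apply pow_lt, hb).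
  assert (hAB : b ^ k <= a ^ k) by (apply pow_incr; lra).
  set (A := a ^ k) in *. set (B := b ^ k) in *. set (m := INR k) in *.
  (* By [a - b = a * b], twice [a * A - b * B] is [a * b * (A + B)] plus [(a + b) * (A - B)]. The
     induction hypothesis bounds the second part; [hc] and [hj] are rearrangement inequalities for
     similarly ordered pairs. *)
  assert (hc : a * b * (A + B) <= a * (a * A) + b * (b * B)).
  { assert (0 <= (a - b) * (a * A - b * B)); [|nra].
    apply Rmult_le_pos; [lra|]. nra. }
  assert (e : a * A - b * B = ((a * b) * (A + B) + (a + b) * (A - B)) / 2)
    by (rewrite hab; field).
  assert (hi : (a + b) * (A - B) <= (a + b) * (m / 2 * (a * A + b * B)))
    by (apply Rmult_le_compat_l; lra).
  assert (hj : (a + b) * (a * A + b * B) <= 2 * (a * (a * A) + b * (b * B))) by nra.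
  assert (m / 2 * ((a + b) * (a * A + b * B))
          <= m / 2 * (2 * (a * (a * A) + b * (b * B))))
    by (apply Rmult_le_compat_l; lra).
  rewrite e. nra.
Qed.

Lemma is_lim_seq_inv_pow (k : nat) (c : R) :
  (1 <= k)%nat -> is_lim_seq (fun n => (/ (c + INR n)) ^ k) 0.
Proof.
  intros hk.
  assert (h : is_lim_seq (fun n => / (c + INR n)) 0).
  { apply (is_lim_seq_inv _ p_infty); [|discriminate].
    apply (is_lim_seq_plus _ _ c p_infty); [apply is_lim_seq_const|
      apply is_lim_seq_INR|reflexivity]. }
  induction k as [|k IH]; [lia|]. simpl.
  destruct k as [|k].
  - apply (is_lim_seq_ext (fun n => / (c + INR n))); [intros; simpl; ring|exact h].
  - replace (Finite 0) with (Finite (0 * 0)) by (f_equal; ring).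
    apply is_lim_seq_mult'; [exact h|]. apply IH. lia.
Qed.

(** The unit intervals centred at [x + 1], [x + 2], ... tile the half-line from [x + 1/2], which is
    where 1/2 comes from. *)
Lemma hurwitz_tail_lt (k : nat) (x : R) :
  (1 <= k)%nat -> 0 <= x -> INR k * hurwitz_tail (S k) x < (/ (x + 1 / 2)) ^ k.
Proof.
  intros hk hx.
  assert (hT := is_series_telescope _ (is_lim_seq_inv_pow k (x + 1 / 2) hk)).
  replace ((/ (x + 1 / 2)) ^ k) with ((/ (x + 1 / 2 + INR 0)) ^ k)
    by (simpl; rewrite Rplus_0_r; reflexivity).
  rewrite <- (is_series_unique _ _ hT). unfold hurwitz_tail.
  rewrite <- Series_scal_l.
  apply Series_lt; [|apply (ex_series_scal_l (K := R_AbsRing) (V := R_NormedModule)),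
    ex_series_hurwitz_tail; [lia|lra]|eexists; exact hT].
  intros n. pose proof (pos_INR n).
  replace (x + 1 / 2 + INR n) with (x + INR (S n) - 1 / 2) by (rewrite S_INR; field).
  replace (x + 1 / 2 + INR (S n)) with (x + INR (S n) + 1 / 2) by ring.
  apply inv_pow_midpoint; [exact hk|]. rewrite S_INR. lra.
Qed.

(** Consecutive trapezoids share endpoints, so every node but [x] counts fully and [x] counts half;
    the correction in [u] makes the estimate telescope. *)
Lemma hurwitz_tail_ge (k : nat) (x : R) :
  (1 <= k)%nat -> 0 < x ->
  (/ x) ^ k - INR k / 2 * (/ x) ^ S k <= INR k * hurwitz_tail (S k) x.
Proof.
  intros hk hx.
  set (u := fun n => (/ (x + INR n)) ^ k - INR k / 2 * (/ (x + INR n)) ^ S k).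
  assert (hu : is_lim_seq u 0).
  { replace (Finite 0) with (Finite (0 - INR k / 2 * 0)) by (f_equal; ring).
    apply is_lim_seq_minus'; [apply is_lim_seq_inv_pow, hk|].
    apply (is_lim_seq_scal_l _ (INR k / 2) 0), is_lim_seq_inv_pow. lia. }
  apply is_series_telescope in hu.
  replace ((/ x) ^ k - INR k / 2 * (/ x) ^ S k) with (u O)
    by (unfold u; change (INR 0) with 0; rewrite Rplus_0_r; reflexivity).
  rewrite <- (is_series_unique _ _ hu).
  unfold hurwitz_tail. rewrite <- Series_scal_l.
  apply Series_mono; [|eexists; exact hu|
    apply (ex_series_scal_l (K := R_AbsRing) (V := R_NormedModule)),
      ex_series_hurwitz_tail; [lia|lra]].
  intros n. unfold u. pose proof (pos_INR n) as hn.
  replace (x + INR (S n)) with (x + INR n + 1) by (rewrite S_INR; ring).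
  pose proof (inv_pow_trapezoid k (x + INR n) ltac:(lra)). lra.
Qed.

(** Splitting off the first term and applying the trapezoidal bound at 1, away from its singularity
    at 0, gives at least [1 + k/2]. *)
Lemma hurwitz_tail_0_gt_1 (k : nat) :
  (1 <= k)%nat -> 1 < INR k * hurwitz_tail (S k) 0.
Proof.
  intros hk.
  assert (e : hurwitz_tail (S k) 0 = 1 + hurwitz_tail (S k) 1).
  { pose proof (Rabs_polygamma_at_1 k hk) as h.
    rewrite Rabs_polygamma in h by (auto; lra). rewrite pow1 in h.
    pose proof (INR_fact_lt_0 k). nra. }
  pose proof (hurwitz_tail_ge k 1 hk Rlt_0_1) as h.
  rewrite Rinv_1, !pow1 in h.
  assert (1 <= INR k) by (apply (le_INR 1); exact hk). rewrite e. lra.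
Qed.

(** * Functions with a single sign change *)

Lemma derive_pos_lt (g g' : R -> R) (a b : R) :
  a < b -> (forall t, is_derive g t (g' t)) -> (forall t, a < t < b -> 0 < g' t) ->
  g a < g b.
Proof.
  intros hab hd hp.
  destruct (MVT_cor2 g g' a b hab) as (c & e & hc).
  - intros t _. apply is_derive_Reals, hd.
  - specialize (hp c hc). nra.
Qed.

(** [g] rises from 0 up to [s] and decreases strictly afterwards; the point [T] certifies that it
    becomes negative, so the decreasing branch has exactly one zero. *)
Lemma unimodal_sign_change (g g' : R -> R) (s T : R) :
  g 0 = 0 -> 0 < s -> 0 < T -> g T < 0 ->
  (forall t, is_derive g t (g' t)) ->
  (forall t, 0 < t < s -> 0 < g' t) -> (forall t, s < t -> g' t < 0) ->
  exists r, 0 < r /\ (forall t, 0 < t < r -> 0 < g t) /\ (forall t, r < t -> g t < 0).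
Proof.
  intros h0 hs hT hgT hd hinc hdec.
  assert (hd' : forall t, is_derive (fun t => - g t) t (- g' t))
    by (intros t; apply (is_derive_opp (V := R_NormedModule)), hd).
  assert (hlo : forall t, 0 < t <= s -> 0 < g t).
  { intros t ht. rewrite <- h0. apply (derive_pos_lt g g'); [lra|exact hd|].
    intros u hu. apply hinc. lra. }
  assert (hhi : forall a b, s <= a -> a < b -> g b < g a).
  { intros a b ha hab.
    pose proof (derive_pos_lt (fun t => - g t) (fun t => - g' t) a b hab hd') as h.
    assert (- g a < - g b); [|lra]. apply h. intros t ht.
    pose proof (hdec t ltac:(lra)). lra. }
  assert (hsT : s < T).
  { apply Rnot_le_lt. intros h. pose proof (hlo T ltac:(lra)). lra. }
  destruct (IVT (fun t => - g t) s T) as (r & hr & e).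
  - intros t. apply continuity_pt_filterlim.
    exact (ex_derive_continuous (V := R_NormedModule) (fun t => - g t) t
             (ex_intro _ _ (hd' t))).
  - exact hsT.
  - pose proof (hlo s ltac:(lra)). lra.
  - lra.
  - assert (e' : g r = 0) by lra. exists r. split; [lra|split].
    + intros t ht. destruct (Rle_lt_dec t s) as [h|h]; [apply hlo; lra|].
      rewrite <- e'. apply hhi; lra.
    + intros t ht. rewrite <- e'. apply hhi; lra.
Qed.

(** The square of [1 + u / 2 <= exp (u / 2)]. Its quadratic term beats linear growth and yields
    explicit points of negativity. *)
Lemma exp_ge_quadratic (u : R) : 0 <= u -> 1 + u + u ^ 2 / 4 <= exp u.
Proof.
  intros hu. replace (exp u) with (exp (u / 2) * exp (u / 2))
    by (rewrite <- exp_plus; f_equal; field).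
  pose proof (exp_ineq1_le (u / 2)). nra.
Qed.

(* The sign of [t * exp (c * t) - (exp t - 1)] is found by differentiating: its
   derivative is [exp (c * t)] times a concave function vanishing at 0. *)
Lemma exp_single_crossing (c : R) :
  1 / 2 < c < 1 ->
  exists r, 0 < r /\
    (forall t, 0 < t < r -> exp (- (c * t)) < t / (exp t - 1)) /\
    (forall t, r < t -> t / (exp t - 1) < exp (- (c * t))).
Proof.
  intros hc. set (d := 1 - c). assert (hd : 0 < d < 1 / 2) by (unfold d; lra).
  assert (hdc : d + c = 1) by (unfold d; ring).
  (* The maximum is where [c = d * exp (d * t)], to the right of 0 because [c > d], that is
     [c > 1/2]. The witness [T = 4 * c / d ^ 2] solves [(d * T) ^ 2 / 4 = c * T], so the quadratic
     bound exceeds [1 + c * T]. *)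
  destruct (unimodal_sign_change (fun t => (1 + c * t) - exp (d * t))
     (fun t => c - d * exp (d * t)) (ln (c / d) / d) (4 * c / d ^ 2))
    as (s & hs & hs1 & hs2).
  - rewrite !Rmult_0_r, exp_0. ring.
  - apply Rdiv_lt_0_compat; [|lra]. rewrite <- ln_1. apply ln_increasing; [lra|].
    apply Rmult_lt_reg_r with d; [lra|]. unfold Rdiv.
    rewrite Rmult_assoc, Rinv_l; lra.
  - apply Rdiv_lt_0_compat; [lra|apply pow_lt; lra].
  - assert (hu : 0 < 4 * c / d) by (apply Rdiv_lt_0_compat; lra).
    pose proof (exp_ge_quadratic (4 * c / d) ltac:(lra)) as h.
    replace (d * (4 * c / d ^ 2)) with (4 * c / d) by (field; lra).
    replace ((4 * c / d) ^ 2 / 4) with (c * (4 * c / d ^ 2)) in h by (field; lra).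
    lra.
  - intros t. auto_derive; [exact I|]. ring.
  - intros t [_ ht]. assert (h : d * t < ln (c / d)).
    { apply (Rmult_lt_compat_l d) in ht; [|lra].
      replace (d * (ln (c / d) / d)) with (ln (c / d)) in ht by (field; lra). exact ht. }
    apply exp_increasing in h. rewrite exp_ln in h by (apply Rdiv_lt_0_compat; lra).
    apply (Rmult_lt_compat_l d) in h; [|lra].
    replace (d * (c / d)) with c in h by (field; lra). lra.
  - intros t ht. assert (h : ln (c / d) < d * t).
    { apply (Rmult_lt_compat_l d) in ht; [|lra].
      replace (d * (ln (c / d) / d)) with (ln (c / d)) in ht by (field; lra). exact ht. }
    apply exp_increasing in h. rewrite exp_ln in h by (apply Rdiv_lt_0_compat; lra).
    apply (Rmult_lt_compat_l d) in h; [|lra].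
    replace (d * (c / d)) with c in h by (field; lra). lra.
  - assert (hfac : forall t, exp t = exp (c * t) * exp (d * t)).
    { intros t. rewrite <- exp_plus. f_equal. rewrite <- Rmult_plus_distr_r.
      replace (c + d) with 1 by lra. ring. }
    (* Here [T = 4 / d ^ 2] solves [(d * T) ^ 2 / 4 = T], so [exp (d * T)] exceeds [1 + T] and
       [exp T] exceeds [T * exp (c * T) + 1]. *)
    destruct (unimodal_sign_change (fun t => t * exp (c * t) - (exp t - 1))
       (fun t => exp (c * t) * ((1 + c * t) - exp (d * t))) s (4 / d ^ 2))
      as (r & hr & hr1 & hr2).
    + rewrite Rmult_0_r, exp_0. ring.
    + exact hs.
    + apply Rdiv_lt_0_compat; [lra|apply pow_lt; lra].
    + assert (hu : 0 < 4 / d) by (apply Rdiv_lt_0_compat; lra).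
      assert (hT : 0 < 4 / d ^ 2) by (apply Rdiv_lt_0_compat; [lra|apply pow_lt; lra]).
      pose proof (exp_ge_quadratic (4 / d) ltac:(lra)) as h.
      rewrite (hfac (4 / d ^ 2)).
      replace (d * (4 / d ^ 2)) with (4 / d) by (field; lra).
      replace ((4 / d) ^ 2 / 4) with (4 / d ^ 2) in h by (field; lra).
      pose proof (exp_ineq1_le (c * (4 / d ^ 2))) as hE.
      assert (hcT : 0 < c * (4 / d ^ 2)) by (apply Rmult_lt_0_compat; lra).
      apply (Rmult_le_compat_l (exp (c * (4 / d ^ 2)))) in h; [|lra]. nra.
    + intros t. auto_derive; [exact I|]. rewrite Rmult_minus_distr_l, <- hfac. ring.
    + intros t ht. apply Rmult_lt_0_compat; [apply exp_pos|apply hs1, ht].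
    + intros t ht. pose proof (exp_pos (c * t)). specialize (hs2 t ht). nra.
    + exists r. split; [exact hr|].
      assert (hpos : forall t, 0 < t -> 0 < exp t - 1).
      { intros t ht. pose proof (exp_ineq1 t ltac:(lra)). lra. }
      split; intros t ht.
      * specialize (hr1 t ht). pose proof (hpos t ltac:(lra)) as hp.
        pose proof (exp_pos (c * t)). rewrite exp_Ropp.
        apply Rmult_lt_reg_r with ((exp t - 1) * exp (c * t)); [nra|].
        field_simplify; lra.
      * specialize (hr2 t ht). pose proof (hpos t ltac:(lra)) as hp.
        pose proof (exp_pos (c * t)). rewrite exp_Ropp.
        apply Rmult_lt_reg_r with ((exp t - 1) * exp (c * t)); [nra|].
        field_simplify; lra.
Qed.

(** * Laplace transforms and the strict lower bound *)

Lemma is_RInt_pos_pow_exp (m : nat) (a : R) :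
  0 < a ->
  is_RInt_pos (fun t => t ^ m * exp (- (a * t))) (INR (fact m) * (/ a) ^ S m).
Proof.
  intros ha. induction m as [|m IH].
  - replace (INR (fact 0) * (/ a) ^ 1) with (0 - - / a) by (simpl; ring).
    apply (is_RInt_pos_derive (fun t => - / a * exp (- (a * t)))).
    + intros t _. auto_derive; [exact I|]. simpl. field. lra.
    + intros t _. apply (ex_derive_continuous (V := R_NormedModule)).
      auto_derive. exact I.
    + apply (filterlim_filter_le_1 (F := locally 0) (G := at_right 0));
        [apply filter_le_within|].
      assert (h : continuous (fun t => - / a * exp (- (a * t))) 0).
      { apply (ex_derive_continuous (V := R_NormedModule)). auto_derive. exact I. }
      unfold continuous in h. rewrite Rmult_0_r, Ropp_0, exp_0, Rmult_1_r in h.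
      exact h.
    + replace (Finite 0) with (Rbar_mult (- / a) 0) by (simpl; f_equal; ring).
      apply is_lim_scal_l.
      apply (is_lim_comp exp (fun t => - (a * t)) p_infty 0 m_infty).
      * apply is_lim_exp_m.
      * apply (is_lim_opp _ _ p_infty).
        apply is_lim_spec. intros M. exists (M / a). intros t ht.
        apply (Rmult_lt_compat_l a) in ht; [|exact ha].
        replace (a * (M / a)) with M in ht by (field; lra). exact ht.
      * exists 0. discriminate.
  (* The zero integral with exponent [S m] has integrand [S m * t ^ m - a * t ^ S m] times the
     exponential, which reduces the power [S m] to [m]. *)
  - pose proof (INR_S_pos m) as hm.
    pose proof (is_RInt_pos_Rpower_exp_derive (INR (S m)) a hm ha) as h0.
    replace (INR (fact (S m)) * (/ a) ^ S (S m))
      with (/ a * (INR (S m) * (INR (fact m) * (/ a) ^ S m) - 0)).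
    + eapply is_RInt_pos_ext; [|exact (is_RInt_pos_scal _ (/ a) _
        (is_RInt_pos_minus _ _ _ _ (is_RInt_pos_scal _ (INR (S m)) _ IH) h0))].
      intros t ht. cbv beta.
      replace (INR (S m) - 1) with (INR m) by (rewrite S_INR; ring).
      rewrite !Rpower_pow, <- tech_pow_Rmult by exact ht. field. lra.
    + replace (fact (S m)) with (S m * fact m)%nat by reflexivity.
      rewrite mult_INR, <- (tech_pow_Rmult (/ a) (S m)). ring.
Qed.

Lemma is_RInt_pos_sum_n (f : nat -> R -> R) (l : nat -> R) (N : nat) :
  (forall n, is_RInt_pos (f n) (l n)) ->
  is_RInt_pos (fun t => sum_n (fun n => f n t) N) (sum_n l N).
Proof.
  intros h. induction N as [|N IH].
  - rewrite sum_O. apply (is_RInt_pos_ext (f O)); [intros; rewrite sum_O; reflexivity|].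
    apply h.
  - rewrite sum_Sn.
    apply (is_RInt_pos_ext (fun t => sum_n (fun n => f n t) N + f (S N) t));
      [intros; rewrite sum_Sn; reflexivity|].
    apply is_RInt_pos_plus; [exact IH|apply h].
Qed.

Lemma sum_exp_geometric (t : R) (N : nat) :
  0 < t ->
  sum_n (fun n => exp (- (INR (S n) * t))) N
  = (1 - exp (- (INR (S N) * t))) / (exp t - 1) :> R.
Proof.
  intros ht. pose proof (exp_ineq1 t ltac:(lra)) as h1.
  pose proof (exp_pos t).
  assert (e : forall n, exp (- (INR (S n) * t)) = exp (- (INR n * t)) / exp t).
  { intros n. unfold Rdiv. rewrite <- exp_Ropp, <- exp_plus. f_equal.
    rewrite S_INR. ring. }
  induction N as [|N IH].
  - rewrite sum_O, e. simpl INR. rewrite Rmult_0_l, Ropp_0, exp_0. field. lra.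
  - rewrite sum_Sn, IH, (e (S N)). change plus with Rplus. field. lra.
Qed.

Lemma inv_exp_sub_bounds (t : R) : 0 < t -> 0 < t / (exp t - 1) < 1.
Proof.
  intros ht. pose proof (exp_ineq1 t ltac:(lra)) as h.
  split; [apply Rdiv_lt_0_compat; lra|].
  apply Rmult_lt_reg_r with (exp t - 1); [lra|].
  unfold Rdiv. rewrite Rmult_assoc, Rinv_l; lra.
Qed.

(* With [t / (exp t - 1) - exp (- c t)] changing sign exactly once, at [r], its product
   with [exp (- x t) - exp (- r x)] has constant sign; the [exp (- r x)] part integrates
   to zero by the choice of [c]. Truncating [1 / (exp t - 1) = sum exp (- n t)] after
   [N] terms costs at most [t ^ m * exp (- N t)]. *)
Lemma hurwitz_tail_gt (k : nat) (c x : R) :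
  (1 <= k)%nat -> 1 / 2 < c < 1 -> 0 < x ->
  (/ c) ^ k = INR k * hurwitz_tail (S k) 0 ->
  (/ (x + c)) ^ k < INR k * hurwitz_tail (S k) x.
Proof.
  intros hk hc hx hck. destruct k as [|m]; [lia|].
  destruct (exp_single_crossing c hc) as (r & hr & hr1 & hr2).
  set (E := exp (- (x * r))). assert (hE : 0 < E) by apply exp_pos.
  set (w := fun t => t / (exp t - 1)).
  set (F := fun t => t ^ m * ((exp (- (x * t)) - E) * (w t - exp (- (c * t))))).
  set (f := fun n t => t ^ S m * exp (- ((x + INR (S n)) * t))
                       - E * (t ^ S m * exp (- (INR (S n) * t)))).
  set (l := fun n => INR (fact (S m)) * (/ (x + INR (S n))) ^ S (S m)
                     - E * (INR (fact (S m)) * (/ INR (S n)) ^ S (S m))).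
  set (B := INR (fact m) * (/ (x + c)) ^ S m - E * (INR (fact m) * (/ c) ^ S m)).
  assert (hf : forall n, is_RInt_pos (f n) (l n)).
  { intros n. pose proof (INR_S_pos n) as hn.
    exact (is_RInt_pos_minus _ _ _ _ (is_RInt_pos_pow_exp (S m) (x + INR (S n)) ltac:(lra))
            (is_RInt_pos_scal _ E _ (is_RInt_pos_pow_exp (S m) (INR (S n)) hn))). }
  (* [Q N] combines integrals known in closed form; its last summand makes it a majorant of [F] on
     both sides of [r]. *)
  set (Q := fun N t => sum_n (fun n => f n t) N
     - (t ^ m * exp (- ((x + c) * t)) - E * (t ^ m * exp (- (c * t))))
     + t ^ m * exp (- (INR (S N) * t))).
  set (L := fun N => sum_n l N - B + INR (fact m) * (/ INR (S N)) ^ S m).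
  assert (hQ : forall N, is_RInt_pos (Q N) (L N)).
  { intros N. apply is_RInt_pos_plus; [apply is_RInt_pos_minus|].
    - apply is_RInt_pos_sum_n, hf.
    - apply is_RInt_pos_minus; [apply is_RInt_pos_pow_exp; lra|].
      apply is_RInt_pos_scal, is_RInt_pos_pow_exp; lra.
    - apply is_RInt_pos_pow_exp, INR_S_pos. }
  assert (hFpos : forall t, 0 < t -> 0 <= F t).
  { intros t ht. unfold F. apply Rmult_le_pos; [apply pow_le; lra|].
    destruct (Rtotal_order t r) as [h|[->|h]].
    - specialize (hr1 t (conj ht h)). fold (w t) in hr1.
      assert (E < exp (- (x * t))) by (apply exp_increasing; nra). nra.
    - unfold E. lra.
    - specialize (hr2 t h). fold (w t) in hr2.
      assert (exp (- (x * t)) < E) by (apply exp_increasing; nra). nra. }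
  assert (hFc : forall t, 0 < t -> continuous F t).
  { intros t ht. apply (ex_derive_continuous (V := R_NormedModule)).
    unfold F, w. pose proof (exp_ineq1 t ltac:(lra)). auto_derive. lra. }
  assert (hFQ : forall N t, 0 < t -> F t <= Q N t).
  { intros N t ht. unfold Q.
    assert (e : sum_n (fun n => f n t) N =
      t ^ S m * (exp (- (x * t)) - E) * sum_n (fun n => exp (- (INR (S n) * t))) N :> R).
    { rewrite <- (sum_n_mult_l (K := R_Ring)). apply sum_n_ext. intros n.
      unfold f. change mult with Rmult.
      replace (- ((x + INR (S n)) * t)) with (- (x * t) + - (INR (S n) * t)) by ring.
      rewrite exp_plus. match goal with |- ?a = ?b => change (a = b :> R) end. ring. }
    rewrite e, sum_exp_geometric by exact ht.
    set (q := exp (- (INR (S N) * t))). assert (hq : 0 < q) by apply exp_pos.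
    pose proof (inv_exp_sub_bounds t ht) as hw. fold (w t) in hw.
    replace (t ^ S m * (exp (- (x * t)) - E) * ((1 - q) / (exp t - 1)))
      with (t ^ m * ((exp (- (x * t)) - E) * (w t * (1 - q))))
      by (unfold w; rewrite <- tech_pow_Rmult; field;
          pose proof (exp_ineq1 t ltac:(lra)); lra).
    replace (- ((x + c) * t)) with (- (x * t) + - (c * t)) by ring.
    rewrite exp_plus. unfold F.
    assert (hxt : 0 < exp (- (x * t)) < 1).
    { split; [apply exp_pos|]. rewrite <- exp_0. apply exp_increasing. nra. }
    assert (0 <= t ^ m * (q * (1 - (exp (- (x * t)) - E) * w t))); [|lra].
    apply Rmult_le_pos; [apply pow_le; lra|]. apply Rmult_le_pos; [lra|]. nra. }
  (* Source of strictness: both factors are positive to the left of [r], and this lower bound, being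
     independent of [N], survives the limit. *)
  assert (hd : 0 < RInt F (r / 3) (r / 2)).
  { apply RInt_gt_0; [lra| |intros; apply hFc; lra].
    intros t ht. unfold F. apply Rmult_lt_0_compat; [apply pow_lt; lra|].
    specialize (hr1 t ltac:(lra)). fold (w t) in hr1.
    assert (E < exp (- (x * t))) by (apply exp_increasing; nra). nra. }
  assert (hLge : forall N, RInt F (r / 3) (r / 2) <= L N).
  { intros N. apply (is_RInt_pos_ge F (Q N)); [exact hFc| |apply hQ|lra|lra].
    intros t ht. split; [apply hFpos, ht|apply hFQ, ht]. }
  set (T := hurwitz_tail (S (S m))) in *.
  assert (hser : is_series l (INR (fact (S m)) * T x - E * (INR (fact (S m)) * T 0))).
  { assert (h1 : forall y, 0 <= y ->
      is_series (fun n => INR (fact (S m)) * (/ (y + INR (S n))) ^ S (S m))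
                (INR (fact (S m)) * T y)).
    { intros y hy. apply (is_series_scal_l (K := R_AbsRing) (V := R_NormedModule)).
      apply Series_correct, ex_series_hurwitz_tail; [lia|exact hy]. }
    apply (is_series_minus (V := R_NormedModule)
             (fun n => INR (fact (S m)) * (/ (x + INR (S n))) ^ S (S m))
             (fun n => E * (INR (fact (S m)) * (/ INR (S n)) ^ S (S m)))).
    - apply h1. lra.
    - apply (is_series_scal_l (K := R_AbsRing) (V := R_NormedModule)).
      apply (is_series_ext (fun n => INR (fact (S m)) * (/ (0 + INR (S n))) ^ S (S m)));
        [intros; rewrite Rplus_0_l; reflexivity|apply h1; lra]. }
  assert (hL : is_lim_seq L (INR (fact (S m)) * T x - E * (INR (fact (S m)) * T 0) - B
                             + INR (fact m) * 0)).
  { apply is_lim_seq_plus'; [apply is_lim_seq_minus'; [exact hser|apply is_lim_seq_const]|].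
    apply (is_lim_seq_scal_l _ (INR (fact m)) 0).
    apply (is_lim_seq_ext (fun n => (/ (1 + INR n)) ^ S m));
      [intros; rewrite S_INR, Rplus_comm; reflexivity|].
    apply is_lim_seq_inv_pow. lia. }
  pose proof (is_lim_seq_le _ _ _ _ hLge (is_lim_seq_const _) hL) as hle. cbn [Rbar_le] in hle.
  (* By the choice of [c] the two terms carrying [E] cancel, leaving [fact m] times the desired
     difference. *)
  unfold B in hle. rewrite hck in hle.
  replace (fact (S m)) with (S m * fact m)%nat in hle by reflexivity.
  rewrite mult_INR in hle. pose proof (INR_fact_lt_0 m) as hfm.
  apply Rmult_lt_reg_l with (INR (fact m)); [exact hfm|]. lra.
Qed.

(** * The lower constant and optimality *)

Lemma pow_lt_reg (k : nat) (a b : R) : 0 <= b -> a ^ k < b ^ k -> a < b.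
Proof.
  intros hb h. apply Rnot_le_lt. intros hab.
  assert (b ^ k <= a ^ k) by (apply pow_incr; lra). lra.
Qed.

Lemma lower_const_spec (k : nat) :
  (1 <= k)%nat ->
  0 < lower_const k /\ (/ lower_const k) ^ k = INR k * hurwitz_tail (S k) 0.
Proof.
  intros hk. split; [apply exp_pos|].
  pose proof (hurwitz_tail_pos (S k) 0 ltac:(lia) ltac:(lra)) as hT.
  assert (hkR : 1 <= INR k) by (apply (le_INR 1); exact hk).
  assert (hf : 0 < INR (fact (k - 1))) by apply INR_fact_lt_0.
  assert (e : INR (fact k) = INR k * INR (fact (k - 1))).
  { destruct k as [|m]; [lia|]. simpl Nat.sub. rewrite Nat.sub_0_r.
    rewrite <- mult_INR. reflexivity. }
  rewrite pow_inv. unfold lower_const.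
  rewrite Rabs_polygamma_at_1, e by exact hk.
  set (q := INR (fact (k - 1)) / (INR k * INR (fact (k - 1)) * hurwitz_tail (S k) 0)).
  assert (hq : 0 < q)
    by (apply Rdiv_lt_0_compat; [exact hf|repeat apply Rmult_lt_0_compat; lra]).
  rewrite <- Rpower_pow by apply exp_pos.
  rewrite Rpower_mult, Rinv_l, Rpower_1 by lra.
  unfold q. field. lra.
Qed.

(** This is the range required by [exp_single_crossing]. The midpoint bound at 0 gives the left
    inequality, [hurwitz_tail_0_gt_1] the right one. *)
Lemma lower_const_bounds (k : nat) : (1 <= k)%nat -> 1 / 2 < lower_const k < 1.
Proof.
  intros hk. destruct (lower_const_spec k hk) as [h0 h].
  set (c := lower_const k) in *.
  assert (hi : 0 < / c) by (apply Rinv_0_lt_compat, h0).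
  split.
  - pose proof (hurwitz_tail_lt k 0 hk (Rle_refl 0)) as hlt. rewrite <- h in hlt.
    apply pow_lt_reg in hlt; [|left; apply Rinv_0_lt_compat; lra].
    apply Rinv_lt_cancel in hlt; lra.
  - pose proof (hurwitz_tail_0_gt_1 k hk) as hgt. rewrite <- h, <- (pow1 k) in hgt.
    apply pow_lt_reg in hgt; [|lra]. rewrite <- Rinv_1 in hgt.
    apply Rinv_lt_cancel in hgt; lra.
Qed.

Lemma Rabs_polygamma_split (k : nat) (x : R) :
  (1 <= k)%nat -> 0 < x ->
  Rabs (polygamma k x) =
    INR (fact (k - 1)) * (INR k * hurwitz_tail (S k) x) + INR (fact k) / x ^ (k + 1).
Proof.
  intros hk hx. rewrite Rabs_polygamma by assumption.
  replace (fact k) with (k * fact (k - 1))%nat.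
  - rewrite mult_INR. unfold Rdiv. ring.
  - destruct k as [|m]; [lia|]. simpl Nat.sub. rewrite Nat.sub_0_r. reflexivity.
Qed.

(** The term [k! / x^(k+1)] is common to both sides, and [(k-1)!] divides out. *)
Lemma polygamma_bound_lt_iff (k : nat) (c x : R) :
  (1 <= k)%nat -> 0 < x ->
  polygamma_bound k c x < Rabs (polygamma k x)
  <-> (/ (x + c)) ^ k < INR k * hurwitz_tail (S k) x.
Proof.
  intros hk hx. rewrite Rabs_polygamma_split by assumption.
  unfold polygamma_bound, Rdiv. rewrite pow_inv.
  pose proof (INR_fact_lt_0 (k - 1)). split; intros h; [|nra].
  apply Rmult_lt_reg_l with (INR (fact (k - 1))); lra.
Qed.

Lemma polygamma_lt_bound_iff (k : nat) (c x : R) :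
  (1 <= k)%nat -> 0 < x ->
  Rabs (polygamma k x) < polygamma_bound k c x
  <-> INR k * hurwitz_tail (S k) x < (/ (x + c)) ^ k.
Proof.
  intros hk hx. rewrite Rabs_polygamma_split by assumption.
  unfold polygamma_bound, Rdiv. rewrite pow_inv.
  pose proof (INR_fact_lt_0 (k - 1)). split; intros h; [|nra].
  apply Rmult_lt_reg_l with (INR (fact (k - 1))); lra.
Qed.

Lemma hurwitz_tail_decr (m : nat) (x y : R) :
  (2 <= m)%nat -> 0 <= x -> x <= y -> hurwitz_tail m y <= hurwitz_tail m x.
Proof.
  intros hm hx hxy.
  apply Series_mono; try (apply ex_series_hurwitz_tail; [exact hm|lra]).
  intros n. pose proof (INR_S_pos n). apply pow_incr. split.
  - left; apply Rinv_0_lt_compat; lra.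
  - apply Rinv_le_contravar; lra.
Qed.

Theorem theorem1 (k : nat) (hk : (1 <= k)%nat) :
  (forall x : R, 0 < x ->
     polygamma_bound k (lower_const k) x
       < Rabs (polygamma k x)
       < polygamma_bound k (1 / 2) x)
  /\
  (forall alpha : R, 0 <= alpha ->
     (forall x : R, 0 < x -> polygamma_bound k alpha x < Rabs (polygamma k x)) ->
     lower_const k <= alpha)
  /\
  (forall beta : R, 0 <= beta ->
     (forall x : R, 0 < x -> Rabs (polygamma k x) < polygamma_bound k beta x) ->
     beta <= 1 / 2).
Proof.
  destruct (lower_const_spec k hk) as [hc0 hck].
  split; [|split].
  - intros x hx. split.
    + apply polygamma_bound_lt_iff; try assumption.
      apply hurwitz_tail_gt; try assumption. apply lower_const_bounds, hk.
    + apply polygamma_lt_bound_iff; try assumption. apply hurwitz_tail_lt; [exact hk|lra].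
  - intros alpha ha h. apply Rnot_lt_le. intros hlt.
    (* At [x = lower_const k - alpha] the shifted argument is [lower_const k], so the assumption
       makes the tail at [x] larger than at 0, against monotonicity. *)
    assert (hx : 0 < lower_const k - alpha) by lra.
    specialize (h _ hx). apply polygamma_bound_lt_iff in h; try assumption.
    replace (lower_const k - alpha + alpha) with (lower_const k) in h by ring.
    rewrite hck in h.
    assert (INR k * hurwitz_tail (S k) (lower_const k - alpha)
            <= INR k * hurwitz_tail (S k) 0); [|lra].
    apply Rmult_le_compat_l; [apply pos_INR|].
    apply hurwitz_tail_decr; [lia|lra|lra].
  - intros beta hb h. apply Rnot_lt_le. intros hlt.
    assert (hkR : 1 <= INR k) by (apply (le_INR 1); exact hk).
    (* [u] plays the role of [1/x]. The trapezoidal bound and Bernoulli's inequality [poly] give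
       [(1 - k u/2)(1 + k beta u) < 1], that is [beta - 1/2 < k beta u / 2]; this [u] makes the
       right side half of the left. *)
    set (u := (beta - 1 / 2) / (INR k * beta)).
    assert (hkb : 0 < INR k * beta) by (apply Rmult_lt_0_compat; lra).
    assert (hu : 0 < u) by (apply Rdiv_lt_0_compat; lra).
    assert (hue : INR k * beta * u = beta - 1 / 2) by (unfold u; field; lra).
    assert (hx : 0 < / u) by (apply Rinv_0_lt_compat, hu).
    specialize (h _ hx). apply polygamma_lt_bound_iff in h; try assumption.
    pose proof (hurwitz_tail_ge k (/ u) hk hx) as hge.
    rewrite Rinv_inv in hge.
    replace (/ (/ u + beta)) with (u * / (1 + beta * u)) in h by (field; nra).
    rewrite Rpow_mult_distr in h. rewrite <- tech_pow_Rmult in hge.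
    assert (huk : 0 < u ^ k) by (apply pow_lt, hu).
    assert (h1 : 1 - INR k / 2 * u < (/ (1 + beta * u)) ^ k).
    { apply Rmult_lt_reg_l with (u ^ k); [exact huk|]. lra. }
    assert (hbu : 0 < beta * u) by nra.
    pose proof (poly k (beta * u) hbu) as hbern.
    rewrite pow_inv in h1.
    assert (h2 : / (1 + beta * u) ^ k <= / (1 + INR k * (beta * u)))
      by (apply Rinv_le_contravar; nra).
    assert (h3 : 1 - INR k / 2 * u < / (1 + INR k * (beta * u))) by lra.
    apply (Rmult_lt_compat_r (1 + INR k * (beta * u))) in h3; [|nra].
    rewrite Rinv_l in h3 by nra. nra.
Qed.
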